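(* Let $2\le m_1\le m_2$ be integers, and let $S\subset D_2^{\mathbb{N}}$ be a sofic system, defined by a finite directed graph $G$ with a right-resolving labelling of its edges by $D_2$, whose adjacency matrix is primitive (some power has all entries positive). If $S$ has uniform complexity, then the sofic set $X=R(S)\subset\mathbb{T}^2$ satisfies $$\dim_{\mathrm H}(X)=\dim_{\mathrm M}(X).$$
   Context: Let $I_i=\{0,1,\dots,m_i-1\}$ for $i=1,2$, $D_1=I_1$ and $D_2=I_1\times I_2$. The map $R:D_2^{\mathbb{N}}\to\mathbb{T}^2=\mathbb{R}^2/\mathbb{Z}^2$ is $R\left((e^{(n)}_1,e^{(n)}_2)_{n\ge1}\right)=\left(\sum_{k=1}^\infty e_1^{(k)}m_1^{-k},\sum_{k=1}^\infty e_2^{(k)}m_2^{-k}\right)$. $\mathbb{T}^2$ carries its standard flat metric; $\dim_{\mathrm H}$ and $\dim_{\mathrm M}$ are Hausdorff and Minkowski (box-counting) dimension. Sofic system: let $G=\langle V,E\rangle$ be a finite directed graph, loops and multiple edges allowed, whose edges are labelled by elements of $D_2$ in a right-resolving fashion, i.e. any two distinct edges emanating from the same vertex have different labels. The set $S\subset D_2^{\mathbb{N}}$ of label sequences of infinite paths in $G$ is the sofic system defined by $G$, and $R(S)$ is the associated sofic set. The adjacency matrix of $G$ has as $(i,j)$ entry the number of edges from $v_i$ to $v_j$, where $V=\{v_1,\dots,v_n\}$. For $s\in D_1$, the restricted adjacency matrix $A_s$ is the $n\times n$ matrix whose $(i,j)$ entry is the number of edges from $v_i$ to $v_j$ whose label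 is $(s,k)$ for some $k\in I_2$. Let $S^{(1)}\subset D_1^{\mathbb{N}}$ be the image of $S$ under $(e^{(n)}_1,e^{(n)}_2)_n\mapsto(e^{(n)}_1)_n$, and let $S^{(1)}|_1\subset D_1$ be the set of first coordinates of elements of $S^{(1)}$. Uniform complexity: $S$ has uniform complexity if all $A_s$ for $s\in S^{(1)}|_1$ have a common Perron-Frobenius eigenvalue and corresponding eigenvector, i.e. there are a positive number $\lambda$ and a vector $v$ with all entries positive such that either $v$ is a row vector with $vA_s=\lambda v$ for every $s\in S^{(1)}|_1$, or $v$ is a column vector with $A_sv=\lambda v$ for every $s\in S^{(1)}|_1$. *)

(* Defs.v *)
From HB Require Import structures.
From mathcomp Require Import all_boot all_order all_algebra.
From mathcomp Require Import generic_quotient.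
From mathcomp Require Import all_classical all_reals all_analysis.
From mathcomp Require Import ring lra.

Set Implicit Arguments.
Unset Strict Implicit.
Unset Printing Implicit Defensive.

Import Order.TTheory GRing.Theory Num.Def Num.Theory.
Import numFieldNormedType.Exports.

Local Open Scope classical_set_scope.
Local Open Scope ring_scope.

Section torus_def.
Variable R : realType.

Definition eqmod1 (x y : R * R) : bool :=
  (x.1 - y.1 \is a Num.int) && (x.2 - y.2 \is a Num.int).

Lemma eqmod1_refl : reflexive eqmod1.
Proof. by move=> x; rewrite /eqmod1 !subrr rpred0. Qed.

Lemma eqmod1_sym : symmetric eqmod1.
Proof.
by move=> x y; rewrite /eqmod1 -(opprB y.1) -(opprB y.2) !rpredN.
Qed.

Lemma eqmod1_trans : transitive eqmod1.
Proof.
move=> y x z /andP[xy1 xy2] /andP[yz1 yz2]; apply/andP; split.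
  by rewrite -(subrK y.1 x.1) -addrA rpredD.
by rewrite -(subrK y.2 x.2) -addrA rpredD.
Qed.

Canonical eqmod1_equiv :=
  EquivRel eqmod1 eqmod1_refl eqmod1_sym eqmod1_trans.

Definition torus : Type := {eq_quot eqmod1_equiv}%qT.

HB.instance Definition _ := Choice.on torus.
HB.instance Definition _ := EqQuotient.on torus.

Definition to_torus (x : R * R) : torus := (\pi_torus x)%qT.

Definition eucl (x y : R * R) : R :=
  Num.sqrt ((x.1 - y.1) ^+ 2 + (x.2 - y.2) ^+ 2).

Definition flat_dist (p q : torus) : R :=
  inf [set eucl xy.1 xy.2 | xy in
        [set xy : (R * R) * (R * R) | to_torus xy.1 = p /\ to_torus xy.2 = q]].

Lemma to_torusP x y : to_torus x = to_torus y <-> eqmod1 x y.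
Proof. by split=> [/eqquotP|h]//; apply/eqquotP. Qed.

Lemma to_torus_repr p : to_torus (repr p) = p.
Proof. exact: reprK. Qed.

Lemma eucl_ge0 x y : 0 <= eucl x y. Proof. exact: sqrtr_ge0. Qed.

Lemma eucl_sym x y : eucl x y = eucl y x.
Proof. by rewrite /eucl -(opprB y.1) -(opprB y.2) !sqrrN. Qed.

Lemma eucl_triangle y x z : eucl x z <= eucl x y + eucl y z.
Proof.
rewrite /eucl.
have -> : x.1 - z.1 = (x.1 - y.1) + (y.1 - z.1) by ring.
have -> : x.2 - z.2 = (x.2 - y.2) + (y.2 - z.2) by ring.
move: (x.1 - y.1) (y.1 - z.1) (x.2 - y.2) (y.2 - z.2) => a b c d.
set u := Num.sqrt (a ^+ 2 + _); set v := Num.sqrt (b ^+ 2 + _).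
have u0 : 0 <= u by exact: sqrtr_ge0.
have v0 : 0 <= v by exact: sqrtr_ge0.
have u2 : u ^+ 2 = a ^+ 2 + c ^+ 2 by rewrite sqr_sqrtr// addr_ge0 ?sqr_ge0.
have v2 : v ^+ 2 = b ^+ 2 + d ^+ 2 by rewrite sqr_sqrtr// addr_ge0 ?sqr_ge0.
have uv : a * b + c * d <= u * v.
  apply: le_trans (ler_norm _) _.
  rewrite -(@ler_pXn2r _ 2) ?nnegrE ?mulr_ge0// exprMn u2 v2 real_normK ?num_real//.
  rewrite -subr_ge0.
  have -> : (a ^+ 2 + c ^+ 2) * (b ^+ 2 + d ^+ 2) - (a * b + c * d) ^+ 2
          = (a * d - b * c) ^+ 2 by ring.
  exact: sqr_ge0.
rewrite -(@ler_pXn2r _ 2) ?nnegrE ?sqrtr_ge0 ?addr_ge0//.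
rewrite sqr_sqrtr ?addr_ge0 ?sqr_ge0// [leRHS]sqrrD u2 v2 !sqrrD mulr2n.
by lra.
Qed.

Lemma eucl_ge x y : `|x.1 - y.1| <= eucl x y /\ `|x.2 - y.2| <= eucl x y.
Proof.
by split; rewrite -sqrtr_sqr ler_sqrt ?addr_ge0 ?sqr_ge0// ?lerDl ?lerDr sqr_ge0.
Qed.

Lemma flat_dist_le x y : flat_dist (to_torus x) (to_torus y) <= eucl x y.
Proof.
apply: ge_inf; last by exists (x, y).
by exists 0 => _ [xy _ <-]; exact: eucl_ge0.
Qed.

Lemma flat_dist_ge p q (r : R) :
  (forall x y, to_torus x = p -> to_torus y = q -> r <= eucl x y) ->
  r <= flat_dist p q.
Proof.
move=> h; apply: lb_le_inf.
  exists (eucl (repr p) (repr q)), (repr p, repr q) => //=.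
  by split; exact: to_torus_repr.
by move=> _ [xy [xp yq] <-]; exact: h.
Qed.

Lemma flat_distxx p : flat_dist p p = 0.
Proof.
apply/eqP; rewrite eq_le; apply/andP; split.
  rewrite -(to_torus_repr p); apply: le_trans (flat_dist_le _ _) _.
  by rewrite /eucl !subrr expr0n/= addr0 sqrtr0.
by apply: flat_dist_ge => *; exact: eucl_ge0.
Qed.

Lemma flat_dist_sym p q : flat_dist p q = flat_dist q p.
Proof.
by apply/eqP; rewrite eq_le; apply/andP; split;
  apply: flat_dist_ge => x y <- <-; rewrite eucl_sym; exact: flat_dist_le.
Qed.

Lemma flat_dist_triangle q p r :
  flat_dist p r <= flat_dist p q + flat_dist q r.
Proof.
rewrite -lerBlDr; apply: flat_dist_ge => x y xp yq.
rewrite lerBlDr addrC -lerBlDr; apply: flat_dist_ge => y' z y'q zr.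
rewrite lerBlDr addrC.
pose z' : R * R := (z.1 + (y.1 - y'.1), z.2 + (y.2 - y'.2)).
have z'r : to_torus z' = r.
  have /to_torusP/andP[h1 h2] : to_torus y = to_torus y' by rewrite yq y'q.
  by rewrite -zr; apply/to_torusP; rewrite /eqmod1 /z'/= !(addrC z.1) !(addrC z.2)
    !addrK h1 h2.
rewrite -xp -z'r; apply: le_trans (flat_dist_le _ _) _.
apply: le_trans (eucl_triangle y _ _) _; rewrite lerD2l.
suff -> : eucl y z' = eucl y' z by [].
by rewrite /eucl /z'/=; congr (Num.sqrt (_ ^+ 2 + _ ^+ 2)); ring.
Qed.

Let away_from_int (t : R) : t \isn't a Num.int ->
  exists2 e : R, 0 < e & forall u, t - u \is a Num.int -> e <= `|u|.
Proof.
move=> tNint; pose f : R := (Num.floor t)%:~R.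
have ft : f < t.
  rewrite lt_neqAle floor_le andbT; apply: contraNneq tNint => <-.
  exact: intr_int.
have tf : t < f + 1 by rewrite /f -intrD1 floorD1_gt.
exists (minr (t - f) (f + 1 - t)); first by rewrite lt_min !subr_gt0 ft.
move=> u /intrP[k tuk].
have -> : u = t - k%:~R by rewrite -tuk; ring.
rewrite ge_min; have [kf|fk] := leP k (Num.floor t).
  apply/orP; left; apply: le_trans (ler_norm _).
  by rewrite lerD2l lerN2 ler_int.
rewrite distrC; apply/orP; right; apply: le_trans (ler_norm _).
by rewrite lerD2r /f -intrD1 ler_int lezD1.
Qed.

Lemma flat_dist_positivity p q : flat_dist p q = 0 -> p = q.
Proof.
rewrite -(to_torus_repr p) -(to_torus_repr q).
move: (repr p) (repr q) => x y xy0; apply/to_torusP; apply/andP.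
have bound (c : R * R -> R) : (forall a b, `|c a - c b| <= eucl a b) ->
    (forall a b, eqmod1 a b -> c a - c b \is a Num.int) ->
    c x - c y \is a Num.int.
  move=> ce ci; apply: contraT => /away_from_int[e e0 he].
  suff : e <= 0 by rewrite leNgt e0.
  rewrite -xy0; apply: flat_dist_ge => a b /to_torusP ax /to_torusP bY.
  apply: le_trans (ce a b); apply: he.
  have -> : c x - c y - (c a - c b) = (c b - c y) - (c a - c x) by ring.
  by rewrite rpredB ?ci.
split; apply: bound => [a b|a b /andP[]//].
- by have [] := eucl_ge a b.
- by have [] := eucl_ge a b.
Qed.

HB.instance Definition _ := isMetric.Build R torus
  flat_distxx flat_dist_positivity flat_dist_sym flat_dist_triangle.

End torus_def.

Section dimensions.
Local Open Scope ereal_scope.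
Context {R : realType} {T : metricType R}.
Implicit Types (X U : set T) (s delta eps : R).

(* The point 0 is added so that the empty set has diameter 0. *)
Definition diam U : \bar R :=
  ereal_sup ([set 0] `|` [set (mdist x y)%:E | x in U & y in U]).

(* (diam U)^s with 0 ^ 0 = 1, except that the empty set always contributes 0,
   so that s = 0 yields the counting measure. *)
Definition hausdorff_gauge s U : \bar R :=
  if U == set0 then 0 else diam U `^ s.

Definition hausdorff_premeasure s delta X : \bar R :=
  ereal_inf [set \sum_(0 <= k <oo) hausdorff_gauge s (U k) | U in
    [set U : (set T)^nat |
      X `<=` \bigcup_k U k /\ forall k, diam (U k) <= delta%:E]].

Definition hausdorff_measure s X : \bar R :=
  ereal_sup [set hausdorff_premeasure s delta X | delta in
    [set delta : R | (0 < delta)%R]].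

Definition hausdorff_dim X : \bar R :=
  ereal_inf [set s%:E | s in
    [set s : R | (0 <= s)%R /\ hausdorff_measure s X = 0]].

Definition covering_number X eps : \bar R :=
  ereal_inf [set n%:R%:E | n in
    [set n : nat | exists U : 'I_n -> set T,
      X `<=` \bigcup_i U i /\ forall i, diam (U i) <= eps%:E]].

Definition box_ratio X eps : \bar R :=
  lne (covering_number X eps) / (ln eps^-1)%:E.

Definition has_minkowski_dim X : Prop :=
  cvg (box_ratio X eps @[eps --> 0^'+]).

Definition minkowski_dim X : \bar R :=
  lim (box_ratio X eps @[eps --> 0^'+]).

End dimensions.

(* Loops and multiple edges are allowed: edges form a type of their own. *)
Record labelled_graph (n m1 m2 : nat) := LabelledGraph {
  edge : finType;
  source : edge -> 'I_n;
  target : edge -> 'I_n;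
  label : edge -> 'I_m1 * 'I_m2
}.

Section sofic.
Context {n m1 m2 : nat}.
Variable G : labelled_graph n m1 m2.

Definition right_resolving : Prop :=
  forall e f : edge G, e <> f -> source e = source f -> label e <> label f.

Definition infinite_path (p : nat -> edge G) : Prop :=
  forall k, target (p k) = source (p k.+1).

Definition sofic_system : set (nat -> 'I_m1 * 'I_m2) :=
  [set w | exists2 p, infinite_path p & forall k, w k = label (p k)].

Definition sofic_proj1 : set (nat -> 'I_m1) :=
  [set (fun k => (w k).1) | w in sofic_system].

Definition sofic_proj1_letters : set 'I_m1 := [set w 0%N | w in sofic_proj1].

Variable R : realType.

Definition adjacency_mx : 'M[R]_n :=
  \matrix_(i, j) #|[set e : edge G | (source e == i) && (target e == j)]%SET|%:R.

Definition restricted_adjacency_mx (s : 'I_m1) : 'M[R]_n :=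
  \matrix_(i, j) #|[set e : edge G | [&& source e == i, target e == j
                                        & (label e).1 == s]]%SET|%:R.

Definition uniform_complexity : Prop :=
  exists2 lambda : R, 0 < lambda &
    (exists2 v : 'rV[R]_n, (forall j, 0 < v ord0 j) &
       forall s, sofic_proj1_letters s ->
         v *m restricted_adjacency_mx s = lambda *: v) \/
    (exists2 v : 'cV[R]_n, (forall i, 0 < v i ord0) &
       forall s, sofic_proj1_letters s ->
         restricted_adjacency_mx s *m v = lambda *: v).

End sofic.

(* The exponent is required to be positive since A ^+ 0 is the identity. *)
Definition primitive_mx (R : realType) (n : nat) (A : 'M[R]_n) : Prop :=
  exists2 k : nat, (0 < k)%N & forall i j, 0 < (A ^+ k) i j.

(* Sequences are indexed from 0, so the k-th digit has weight m ^ -(k + 1). *)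
Definition digit_expansion (R : realType) (m : nat) (e : nat -> 'I_m) : R :=
  limn (series (fun k => (e k)%:R / m%:R ^+ k.+1 : R)).

Definition representation_map (R : realType) (m1 m2 : nat)
    (w : nat -> 'I_m1 * 'I_m2) : torus R :=
  to_torus (digit_expansion R (fun k => (w k).1),
            digit_expansion R (fun k => (w k).2)).

Definition sofic_set (R : realType) (n m1 m2 : nat)
    (G : labelled_graph n m1 m2) : set (torus R) :=
  [set representation_map R w | w in sofic_system G].

Arguments sofic_set R {n m1 m2} G.

(* Main.v *)
(* Let q be the number of first-coordinate letters, lam the common eigenvalue,
   L(j) the largest L with m2 ^ L <= m1 ^ j, and
   t = ln q / ln m1 + ln lam / ln m2.  Approximate squares of level j fix the
   first j digits of the first coordinate and the first L(j) digits of the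
   second one; their side is comparable to m1 ^ -j.  The positive common
   eigenvector, on either side, shows that the number of walks whose first
   letters are prescribed on k steps and free on r steps is lam ^ k (q lam) ^ r
   up to constants.  Hence about lam ^ L(j) q ^ j ~ (m1 ^ j) ^ t approximate
   squares of level j meet the sofic set, which bounds both dimensions above by
   t.  Conversely, among the walks of a large length N, the proportion lying in
   a given approximate square of level j is at most C / (lam ^ L(j) q ^ j).  A
   set of diameter at most m1 ^ -j meets at most 25 such squares, and by Konig's
   lemma a countable cover by unions of squares has a finite subcover, so
   counting walks of length N gives the mass distribution bound with exponent t,
   without constructing a measure. *)
Require Import Defs.
From HB Require Import structures.
From mathcomp Require Import all_boot all_order all_algebra.
From mathcomp Require Import all_classical all_reals all_analysis.
From mathcomp Require Import ring lra zify.

Set Implicit Arguments.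
Unset Strict Implicit.
Unset Printing Implicit Defensive.

Import Order.TTheory GRing.Theory Num.Def Num.Theory.
Import numFieldNormedType.Exports.

Local Open Scope classical_set_scope.
Local Open Scope ring_scope.

(** * Dimensions from coverings and mass bounds *)

Lemma powR_small (R : realType) (a e : R) : 0 < a -> 0 < e ->
  exists2 x0 : R, 0 < x0 & forall x, 0 < x -> x <= x0 -> x `^ a <= e.
Proof.
move=> a0 e0; exists (e `^ a^-1); first exact: powR_gt0.
move=> x x0 xe; apply: le_trans (ge0_ler_powR (ltW a0) _ _ xe) _.
- by rewrite nnegrE ltW.
- by rewrite nnegrE powR_ge0.
- by rewrite -powRrM mulVf ?gt_eqF// powRr1// ltW.
Qed.

Lemma diam_ge0 (R : realType) (T : metricType R) (U : set T) : (0 <= diam U)%E.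
Proof. by apply: ereal_sup_ubound; left. Qed.

Lemma hausdorff_gauge_ge0 (R : realType) (T : metricType R) (s : R) (U : set T) :
  (0 <= hausdorff_gauge s U)%E.
Proof. by rewrite /hausdorff_gauge; case: ifP => // _; exact: poweR_ge0. Qed.

Lemma diam_le (R : realType) (T : metricType R) (U : set T) (d : R) :
  0 <= d -> (forall x y, U x -> U y -> mdist x y <= d) -> (diam U <= d%:E)%E.
Proof.
move=> d0 h; apply: ge_ereal_sup => _ [->|[x Ux [y Uy <-]]]; first by rewrite lee_fin.
by rewrite lee_fin h.
Qed.

Lemma mdist_le_diam (R : realType) (T : metricType R) (U : set T) (d : R) x y :
  (diam U <= d%:E)%E -> U x -> U y -> mdist x y <= d.
Proof.
move=> Ud Ux Uy; rewrite -lee_fin; apply: le_trans Ud.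
by apply: ereal_sup_ubound; right; exists x => //; exists y.
Qed.

Lemma hausdorff_gauge_le (R : realType) (T : metricType R) (s d : R) (U : set T) :
  0 <= s -> 0 <= d -> (diam U <= d%:E)%E -> (hausdorff_gauge s U <= (d `^ s)%:E)%E.
Proof.
move=> s0 d0 Ud; rewrite /hausdorff_gauge; case: ifP => _.
  by rewrite lee_fin powR_ge0.
rewrite -poweR_EFin; apply: gt0_ler_poweR => //.
  by rewrite in_itv/= diam_ge0 leey.
by rewrite in_itv/= lee_fin d0 leey.
Qed.

(** The finite cover is padded with empty sets, whose gauge is 0 for every exponent, including
    [s = 0]. *)
Lemma hausdorff_premeasure_le (R : realType) (T : metricType R) (X : set T)
    (s delta eps : R) (n : nat) (U : 'I_n -> set T) :
  0 <= s -> 0 <= eps -> eps <= delta ->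
  X `<=` \bigcup_i U i -> (forall i, (diam (U i) <= eps%:E)%E) ->
  (hausdorff_premeasure s delta X <= (n%:R * eps `^ s)%:E)%E.
Proof.
move=> s0 eps0 epsd XU Ueps.
pose V k : set T := if insub k is Some i then U i else set0.
have Veps k : (diam (V k) <= eps%:E)%E.
  rewrite /V; case: insubP => [i _ _|_]; first exact: Ueps.
  by apply: diam_le.
apply: (@le_trans _ _ (\sum_(0 <= k <oo) hausdorff_gauge s (V k))%E).
  apply: ereal_inf_lbound; exists V => //; split.
    move=> x /XU[i _ Uix]; exists (i : nat) => //; rewrite /V insubT//= => lti.
    by congr (U _ x): Uix; exact: val_inj.
  by move=> k; apply: le_trans (Veps k) _; rewrite lee_fin.
rewrite (nneseries_split 0%N n); last by move=> *; exact: hausdorff_gauge_ge0.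
rewrite [X in (_ + X)%E]eseries0 ?adde0; last first.
  move=> k; rewrite add0n => nk _; rewrite /V insubF; last by rewrite ltnNge nk.
  by rewrite /hausdorff_gauge eqxx.
rewrite add0n.
apply: le_trans (lee_sum _ _) _ => [k _|].
  exact: hausdorff_gauge_le s0 eps0 (Veps k).
by rewrite sumEFin lee_fin big_const_nat subn0 iter_addr_0 mulr_natl.
Qed.

(** At exponent [t + a] the cover of mesh [eps] has gauge sum at most C eps^a, which tends to 0;
    hence the measure vanishes for every [a > 0]. *)
Lemma hausdorff_dim_le (R : realType) (T : metricType R) (X : set T) (C t : R) :
  0 < C -> 0 <= t ->
  (forall eps : R, 0 < eps -> eps < 1 ->
     exists n (U : 'I_n -> set T), [/\ X `<=` \bigcup_i U i,
       forall i, (diam (U i) <= eps%:E)%E & n%:R <= C * eps `^ (- t)]) ->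
  (hausdorff_dim X <= t%:E)%E.
Proof.
move=> C0 t0 XC; apply/lee_addgt0Pr => a a0.
apply: ereal_inf_lbound; exists (t + a) => //; split; first by rewrite addr_ge0// ltW.
have ta : 0 <= t + a by rewrite addr_ge0// ltW.
suff H delta : 0 < delta -> hausdorff_premeasure (t + a) delta X = 0%E.
  rewrite /hausdorff_measure; apply/eqP; rewrite eq_le; apply/andP; split.
    by apply: ge_ereal_sup => _ [d d0 <-]; rewrite H.
  by apply: ereal_sup_ubound; exists 1 => //=; rewrite H.
move=> d0; apply/eqP; rewrite eq_le; apply/andP; split; last first.
  apply: le_ereal_inf_tmp => _ [U _ <-]; apply: nneseries_ge0 => *.
  exact: hausdorff_gauge_ge0.
apply/lee_addgt0Pr => e e0; rewrite add0e.
(* Below [x0] one has eps^a <= e / C, which makes the gauge sum at most [e]. *)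
have [x0 x00 hx0] := powR_small a0 (divr_gt0 e0 C0).
pose eps := minr (minr delta 2^-1) x0.
have eps0 : 0 < eps by rewrite !lt_min d0 x00 invr_gt0 ltr0n.
have eps1 : eps < 1 by rewrite !gt_min invf_lt1 ?ltr1n ?orbT.
have epsx : eps <= x0 by rewrite ge_min lexx orbT.
have epsd : eps <= delta by rewrite !ge_min lexx.
have [n [U [XU Ueps nC]]] := XC eps eps0 eps1.
apply: le_trans (hausdorff_premeasure_le ta (ltW eps0) epsd XU Ueps) _.
rewrite lee_fin; apply: le_trans (ler_wpM2r (powR_ge0 _ _) nC) _.
rewrite -mulrA -powRD; last by apply/implyP => _; rewrite gt_eqF.
rewrite addrA addNr add0r mulrC -ler_pdivlMr//.
exact: hx0.
Qed.

(* The conclusion of the mass distribution principle, with d k in place of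
   diam (U k) so that sets of diameter 0 can be given a positive size. *)
Definition mass_bound (R : realType) (T : metricType R) (X : set T) (c t : R) : Prop :=
  forall (D : pred nat) (U : nat -> set T) (d : nat -> R),
    (forall k, D k -> 0 < d k <= 1) -> (forall k, D k -> (diam (U k) <= (d k)%:E)%E) ->
    X `<=` [set x | exists2 k, D k & U k x] ->
    exists K, c <= \sum_(0 <= k < K | D k) d k `^ t.

(** If the [s]-measure vanished for some [s < t], some cover would have gauge sum below c / 2.
    Replacing zero diameters by tiny sizes costs at most another c / 2, against the mass bound
    [c]. *)
Lemma hausdorff_dim_ge (R : realType) (T : metricType R) (X : set T) (c t : R) :
  0 < c -> mass_bound X c t -> (t%:E <= hausdorff_dim X)%E.
Proof.
move=> c0 Xc; apply: le_ereal_inf_tmp => _ [s [s0 Hs] <-]; rewrite lee_fin.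
rewrite leNgt; apply/negP => st.
have t0 : 0 < t by exact: le_lt_trans st.
have : (hausdorff_premeasure s 1 X < (c / 2)%:E)%E.
  apply: (@le_lt_trans _ _ (hausdorff_measure s X)).
    by apply: ereal_sup_ubound; exists 1 => //=.
  by rewrite Hs lte_fin divr_gt0.
move=> /ereal_inf_lt[_ [U [XU U1] <-]] sumU.
pose D k : bool := U k != set0.
have diamE k : exists2 r : R, 0 <= r <= 1 & diam (U k) = r%:E.
  have := U1 k; have := diam_ge0 (U k); case: (diam (U k)) => [r| |] //.
  by rewrite !lee_fin => r0 r1; exists r => //; rewrite r0.
(* Geometric error terms: all their partial sums stay below c / 2. *)
pose e k : R := c / 2 * (2^-1) ^+ k.+1.
have e0 k : 0 < e k by rewrite mulr_gt0 ?divr_gt0 ?exprn_gt0 ?invr_gt0.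
have dE k : exists d : R, D k -> [/\ 0 < d <= 1, (diam (U k) <= d%:E)%E &
    ((d `^ t)%:E <= hausdorff_gauge s (U k) + (e k)%:E)%E].
  have [r /andP[r0 r1] rE] := diamE k; have [{}r0|] := ltP 0 r.
    (* A positive diameter is kept as it is: r^t <= r^s because [r <= 1] and [s < t]. *)
    exists r => Dk; split; rewrite ?r0 ?rE//.
    rewrite /hausdorff_gauge (negbTE Dk) rE poweR_EFin -EFinD lee_fin.
    apply: ler_wpDr (ltW (e0 _)) _; apply: ger_powR (ltW st).
    by rewrite r0.
  move=> rle0; have r00 : r = 0 by apply/eqP; rewrite eq_le rle0.
  (* A set of diameter 0 receives a size so small that its [t]-th power is absorbed by [e k]. *)
  have [x0 x00 hx0] := powR_small t0 (e0 k).
  exists (minr 1 x0) => Dk; split.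
  - by rewrite lt_min ltr01 x00/= ge_min lexx.
  - by rewrite rE r00 lee_fin le_min ler01 ltW.
  - rewrite -[leLHS]add0e leeD ?hausdorff_gauge_ge0// lee_fin hx0//.
      by rewrite lt_min ltr01 x00.
    by rewrite ge_min lexx orbT.
have {dE}[d dP] := choice dE.
have [k Dk|k Dk||K cK] := Xc D U d.
- by have [] := dP k Dk.
- by have [] := dP k Dk.
- move=> x /XU[k _ Ukx]; exists k => //; apply/eqP => U0.
  by move: Ukx; rewrite U0.
have geom n : \sum_(0 <= k < n) e k = c / 2 * (1 - 2^-1 ^+ n).
  elim: n => [|n IH]; first by rewrite big_nil expr0 subrr mulr0.
  by rewrite big_nat_recr//= IH /e -mulrDr exprS; congr (_ * _); field.
suff : (c%:E < c%:E)%E by rewrite ltxx.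
apply: le_lt_trans (_ : ((\sum_(0 <= k < K | D k) d k `^ t)%:E < _)%E).
  by rewrite lee_fin.
apply: le_lt_trans (_ : (\sum_(0 <= k < K) hausdorff_gauge s (U k) +
   (\sum_(0 <= k < K) e k)%:E < _)%E).
  rewrite -!sumEFin -big_split/= [leLHS]big_mkcond/=; apply: lee_sum => k _.
  case: ifPn => Dk; first by have [] := dP k Dk.
  by rewrite adde_ge0 ?hausdorff_gauge_ge0// lee_fin ltW.
rewrite geom.
have -> : (c%:E = (c / 2)%:E + (c / 2)%:E)%E by rewrite -EFinD -splitr.
apply: lte_leD => //; last first.
  by rewrite lee_fin ger_pMr ?divr_gt0// gerBl exprn_ge0// invr_ge0.
apply: le_lt_trans sumU; apply: nneseries_lim_ge => *.
exact: hausdorff_gauge_ge0.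
Qed.

Lemma covering_number_le (R : realType) (T : metricType R) (X : set T) (eps : R)
    (n : nat) (U : 'I_n -> set T) :
  X `<=` \bigcup_i U i -> (forall i, (diam (U i) <= eps%:E)%E) ->
  (covering_number X eps <= n%:R%:E)%E.
Proof. by move=> XU Ueps; apply: ereal_inf_lbound; exists n => //; exists U. Qed.

(** The mass bound, applied with the constant size [eps] on [n] indices, reads c <= n eps^t. *)
Lemma covering_number_ge (R : realType) (T : metricType R) (X : set T) (c t eps : R) :
  0 < eps -> eps < 1 -> mass_bound X c t ->
  ((c * eps `^ (- t))%:E <= covering_number X eps)%E.
Proof.
move=> eps0 eps1 Xc; apply: le_ereal_inf_tmp => _ [n [U [XU Ueps]] <-].
rewrite lee_fin powRN ler_pdivrMr ?powR_gt0//.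
pose V k : set T := if insub k is Some i then U i else set0.
have [k _|k|x|K] := Xc (fun k => (k < n)%N) V (fun=> eps).
- by rewrite eps0 ltW.
- by rewrite /V => kn; rewrite insubT.
- move=> /XU[i _ Uix]; exists (i : nat) => //; rewrite /V insubT//= => lti.
  by congr (U _ x): Uix; exact: val_inj.
move=> /le_trans; apply.
rewrite big_const_seq iter_addr_0 -[leLHS]mulr_natl.
apply: ler_wpM2r; rewrite ?powR_ge0// ler_nat.
rewrite /index_iota subn0 -size_filter -[leqRHS](size_iota 0).
apply: uniq_leq_size; first by rewrite filter_uniq// iota_uniq.
by move=> k; rewrite mem_filter !mem_iota => /andP[/= kn _].
Qed.

(** After taking logarithms, a bound a eps^(-t) becomes ln a / ln(1/eps) + t, and the first term
    tends to 0; the quotient is squeezed between two such expressions. *)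
Lemma ln_cvg_ratio (R : realType) (f : R -> R) (c C t : R) :
  0 < c -> 0 < C ->
  (forall eps, 0 < eps -> eps < 1 ->
     c * eps `^ (- t) <= f eps /\ f eps <= C * eps `^ (- t)) ->
  ln (f eps) / ln eps^-1 @[eps --> 0^'+] --> t.
Proof.
move=> c0 C0 hf.
have invln : (fun e : R => (ln e^-1)^-1) @ 0^'+ --> (0 : R).
  apply/(gtr0_cvgV0 (f := fun e : R => ln e^-1)).
    near=> e; rewrite ln_gt0// invf_gt1; last by [].
    by near: e; exact: nbhs_right_lt.
  apply/cvgryPge => A; near=> e.
  have e0 : 0 < e by [].
  rewrite -ler_expR lnK ?posrE ?invr_gt0//.
  rewrite -[leLHS]invrK lef_pV2 ?posrE ?invr_gt0 ?expR_gt0//.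
  by near: e; apply: nbhs_right_le; rewrite invr_gt0 expR_gt0.
have cst (a : R) : ln a / ln (eps : R)^-1 + t @[eps --> 0^'+] --> t.
  rewrite -[X in _ --> X]add0r; apply: cvgD; last exact: cvg_cst.
  by rewrite -[X in _ --> X](mulr0 (ln a)); apply: cvgMr.
apply: (squeeze_cvgr _ (cst c) (cst C)); near=> e.
have e0 : 0 < e by [].
have e1 : e < 1 by near: e; exact: nbhs_right_lt.
have L0 : 0 < ln e^-1 by rewrite ln_gt0// invf_gt1.
have [h1 h2] := hf e e0 e1.
have p0 : 0 < e `^ (- t) by exact: powR_gt0.
have f0 : 0 < f e by apply: lt_le_trans h1; rewrite mulr_gt0.
have E a : 0 < a -> ln a / ln e^-1 + t = ln (a * e `^ (- t)) / ln e^-1.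
  move=> a0; rewrite lnM ?posrE// mulrDl; congr (_ + _).
  by rewrite ln_powR lnV ?posrE// invrN mulrN !mulNr opprK mulfK// lt_eqF// ln_lt0 // e0.
by rewrite !E// !ler_pM2r ?invr_gt0// !ler_ln ?posrE ?mulr_gt0// h1 h2.
Unshelve. all: by end_near.
Qed.

(** The two-sided bound makes the covering number finite and positive for [eps < 1], so the extended
    logarithm and quotient are the real ones and [ln_cvg_ratio] applies. *)
Lemma box_ratio_cvg (R : realType) (T : metricType R) (X : set T) (c C t : R) :
  0 < c -> 0 < C -> mass_bound X c t ->
  (forall eps : R, 0 < eps -> eps < 1 ->
     exists n (U : 'I_n -> set T), [/\ X `<=` \bigcup_i U i,
       forall i, (diam (U i) <= eps%:E)%E & n%:R <= C * eps `^ (- t)]) ->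
  box_ratio X eps @[eps --> 0^'+] --> t%:E.
Proof.
move=> c0 C0 Xc XC.
have bnd eps : 0 < eps -> eps < 1 ->
    exists2 r : R, covering_number X eps = r%:E &
      c * eps `^ (- t) <= r /\ r <= C * eps `^ (- t).
  move=> e0 e1; have := covering_number_ge e0 e1 Xc.
  have [n [U [XU Ue nC]]] := XC eps e0 e1.
  have := covering_number_le XU Ue.
  case: (covering_number X eps) => [r| |] //; rewrite !lee_fin => rn cr.
  by exists r => //; split => //; exact: le_trans nC.
have ratioE e : 0 < e -> e < 1 ->
    box_ratio X e = (ln (fine (covering_number X e)) / ln e^-1)%:E.
  move=> e0 e1; have [r E [cr rC]] := bnd e e0 e1.
  have r0 : 0 < r by apply: lt_le_trans cr; rewrite mulr_gt0// powR_gt0.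
  rewrite /box_ratio E/= leNgt r0/= inver.
  have L0 : 0 < ln e^-1 by rewrite ln_gt0// invf_gt1.
  by rewrite (gt_eqF L0).
apply: cvg_EFin.
  near=> e; have e0 : 0 < e by [].
  by rewrite ratioE//; near: e; exact: nbhs_right_lt.
apply: cvg_trans (@ln_cvg_ratio R (fun e => fine (covering_number X e)) c C t c0 C0 _);
  last by move=> e e0 e1; have [r -> ?] := bnd e e0 e1.
 apply: near_eq_cvg; near=> e.
have e0 : 0 < e by [].
by rewrite /= ratioE//; near: e; exact: nbhs_right_lt.
Unshelve. all: by end_near.
Qed.

Lemma dimensions_eq (R : realType) (T : metricType R) (X : set T) (c C t : R) :
  0 < c -> 0 < C -> 0 <= t -> mass_bound X c t ->
  (forall eps : R, 0 < eps -> eps < 1 ->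
     exists n (U : 'I_n -> set T), [/\ X `<=` \bigcup_i U i,
       forall i, (diam (U i) <= eps%:E)%E & n%:R <= C * eps `^ (- t)]) ->
  has_minkowski_dim X /\ hausdorff_dim X = minkowski_dim X.
Proof.
move=> c0 C0 t0 Xc XC; have cvgt := box_ratio_cvg c0 C0 Xc XC.
have mt : minkowski_dim X = t%:E by exact: cvg_lim cvgt.
split; first by apply/cvg_ex; exists t%:E.
apply/eqP; rewrite mt eq_le (hausdorff_dim_le C0 t0 XC) /=.
exact: hausdorff_dim_ge c0 Xc.
Qed.

(** * Digit expansions and approximate squares *)

(** The integer whose base [m] digits are the first [k] terms of [e]: the numerator over m^k of the
    [k]-th partial sum of the expansion. *)
Fixpoint digit_prefix (m : nat) (e : nat -> 'I_m) (k : nat) : nat :=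
  if k is k'.+1 then (digit_prefix e k' * m + e k')%N else 0%N.

Lemma digit_prefix_lt (m : nat) (e : nat -> 'I_m) k : (digit_prefix e k < m ^ k)%N.
Proof.
elim: k => [|k IH] //=; rewrite expnS.
apply: (@leq_trans ((digit_prefix e k).+1 * m)); last by rewrite mulnC leq_mul2l IH orbT.
by rewrite mulSn addnC ltn_add2r ltn_ord.
Qed.

Lemma digit_prefix_inj (m : nat) (e f : nat -> 'I_m) k :
  digit_prefix e k = digit_prefix f k <-> forall i, (i < k)%N -> e i = f i.
Proof.
elim: k => [|k IH] //=; split=> [ef|ef].
  have m0 : (0 < m)%N by exact: leq_ltn_trans (ltn_ord (e k)).
  have ek : e k = f k.
    apply: val_inj; have := congr1 (modn^~ m) ef.
    by rewrite /= !modnMDl !modn_small.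
  move: ef; rewrite ek => /addIn/eqP; rewrite eqn_pmul2r// => /eqP/IH ef i.
  by rewrite ltnS leq_eqVlt => /predU1P[->//|/ef].
by rewrite ef// (IH.2 _)// => i ik; rewrite ef// ltnS ltnW.
Qed.

(** The left endpoints are the partial sums and increase to the limit, while the right endpoints
    decrease. The interval is closed, since a tail of maximal digits reaches its right end. *)
Lemma digit_expansion_bounds (R : realType) (m : nat) (e : nat -> 'I_m) k :
  (0 < m)%N ->
  (digit_prefix e k)%:R / m%:R ^+ k <= digit_expansion R e <=
  (digit_prefix e k).+1%:R / m%:R ^+ k.
Proof.
move=> m0; have mn0 : m%:R != 0 :> R by rewrite pnatr_eq0 -lt0n.
have mp j : 0 < m%:R ^+ j :> R by rewrite exprn_gt0// ltr0n.
pose u := series (fun k => (e k)%:R / m%:R ^+ k.+1 : R).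
have uE j : u j = (digit_prefix e j)%:R / m%:R ^+ j.
  elim: j => [|j IH]; first by rewrite /u /series/= big_nil mul0r.
  rewrite /u seriesSr -/u IH natrD natrM exprS mulrDl; congr (_ + _).
  by rewrite [X in _ = X / _]mulrC -mulf_div divff// mul1r.
have undec : nondecreasing_seq u.
  by apply/nondecreasing_seqP => j; rewrite /u seriesSr lerDl divr_ge0// ltW.
(* A digit plus one is at most [m], so refining by one digit cannot move the right endpoint
   upwards. *)
have vninc j : (digit_prefix e (j + k)).+1%:R / m%:R ^+ (j + k) <=
    (digit_prefix e k).+1%:R / m%:R ^+ k :> R.
  elim: j => [|j]; first by rewrite add0n.
  apply: le_trans; rewrite addSn exprS.
  rewrite ler_pdivrMr ?mulr_gt0 ?ltr0n// mulrAC mulrA mulfK ?gt_eqF//.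
  rewrite -natrM ler_nat /=.
  by rewrite -addnS mulSn addnC leq_add2r.
have ub j : u j <= (digit_prefix e k).+1%:R / m%:R ^+ k.
  apply: le_trans (undec _ (j + k)%N (leq_addr _ _)) _.
  rewrite uE; apply: le_trans (vninc j).
  by rewrite ler_pM2r ?invr_gt0// ler_nat.
have cu : cvgn u.
  apply: nondecreasing_is_cvgn => //.
  by exists ((digit_prefix e k).+1%:R / m%:R ^+ k) => _ [j _ <-]; exact: ub.
apply/andP; split; last by apply: limr_le => //; exact: nearW.
rewrite -uE; exact: nondecreasing_cvgn_le.
Qed.

(** The distance is an infimum over representatives, so the strict inequality provides a pair of
    them at Euclidean distance below [r]; their integer translations give [z1] and [z2]. *)
Lemma flat_dist_coord (R : realType) (x y : R * R) (r : R) :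
  flat_dist (to_torus x) (to_torus y) < r ->
  exists z1 z2 : int, `|x.1 - y.1 - z1%:~R| < r /\ `|x.2 - y.2 - z2%:~R| < r.
Proof.
move=> xyr; apply: contrapT => H; move: xyr; rewrite ltNge => /negP; apply.
apply: flat_dist_ge => x' y' /to_torusP/andP[/intrP[a1 E1] /intrP[a2 E2]].
move=> /to_torusP/andP[/intrP[b1 F1] /intrP[b2 F2]].
rewrite leNgt; apply/negP => xyr; apply: H; exists (b1 - a1), (b2 - a2).
have [h1 h2] := eucl_ge x' y'.
rewrite !intrB -E1 -E2 -F1 -F2; split.
  by apply: le_lt_trans xyr; apply: le_trans h1; rewrite le_eqVlt; apply/orP; left;
     apply/eqP; congr `|_|; ring.
by apply: le_lt_trans xyr; apply: le_trans h2; rewrite le_eqVlt; apply/orP; left;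
     apply/eqP; congr `|_|; ring.
Qed.

(* The residues at cyclic distance at most 2 from b; adding 2 * M keeps the
   truncated subtraction exact. *)
Definition cyclic_neighbours (M b : nat) : seq nat :=
  [seq ((b + 2 * M - 2 + i) %% M)%N | i <- iota 0 5].

(** After scaling by [M], the integer a - b - z M differs from a real of modulus below 2 by at most
    1, so it lies strictly between -3 and 3: five residues remain. *)
Lemma cyclic_neighboursP (R : realType) (M a b : nat) (x y : R) (z : int) :
  (a < M)%N ->
  a%:R / M%:R <= x <= a.+1%:R / M%:R -> b%:R / M%:R <= y <= b.+1%:R / M%:R ->
  `|x - y - z%:~R| < 2 / M%:R -> a \in cyclic_neighbours M b.
Proof.
move=> aM; have M0 : 0 < M%:R :> R by rewrite ltr0n; exact: leq_ltn_trans aM.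
rewrite !ler_pdivrMr// !ler_pdivlMr// => /andP[xa1 xa2] /andP[yb1 yb2].
rewrite ltr_pdivlMr// -[X in _ * X](gtr0_norm M0) -normrM ltr_norml !mulrBl => /andP[h1 h2].
pose k : int := a%:Z - b%:Z - z * M%:Z.
have kE : k%:~R = a%:R - b%:R - z%:~R * M%:R :> R by rewrite !intrB intrM .
have k1 : k < 3.
  by rewrite -(ltr_int R) kE; move: xa1 xa2 yb1 yb2 h1 h2; rewrite -!natr1; lra.
have k2 : -3 < k.
  by rewrite -(ltr_int R) kE; move: xa1 xa2 yb1 yb2 h1 h2; rewrite -!natr1; lra.
pose i := absz (k + 2).
apply/mapP; exists i; first by rewrite mem_iota /i; lia.
apply/eqP; rewrite -eqz_nat -!modz_nat.
have -> : (b + 2 * M - 2 + i)%N%:Z = (2 - z) * M%:Z + a%:Z by rewrite /i /k in k1 k2 *; nia.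
by rewrite modzMDl modz_nat modn_small.
Qed.

Lemma eucl_le_norm (R : realType) (x y : R * R) :
  eucl x y <= `|x.1 - y.1| + `|x.2 - y.2|.
Proof.
rewrite /eucl; move: (x.1 - y.1) (x.2 - y.2) => a b.
rewrite -(@ler_pXn2r _ 2) ?nnegrE ?sqrtr_ge0 ?addr_ge0//.
rewrite sqr_sqrtr ?addr_ge0 ?sqr_ge0// sqrrD !real_normK ?num_real//.
by rewrite addrAC lerDl mulrn_wge0// mulr_ge0.
Qed.

(* m2 ^ - square_depth m1 m2 j is comparable to m1 ^ - j, so fixing j first
   digits and square_depth m1 m2 j second digits gives an approximate square. *)
Definition square_depth (m1 m2 j : nat) : nat := trunc_log m2 (m1 ^ j).

Lemma square_depth_bounds (m1 m2 j : nat) : (2 <= m1)%N -> (m1 <= m2)%N ->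
  (m2 ^ square_depth m1 m2 j <= m1 ^ j < m2 ^ (square_depth m1 m2 j).+1)%N.
Proof.
move=> m12 mm; apply: trunc_log_bounds; first exact: leq_trans mm.
by rewrite expn_gt0 (leq_trans _ m12).
Qed.

Lemma square_depth_le (m1 m2 j : nat) : (2 <= m1)%N -> (m1 <= m2)%N ->
  (square_depth m1 m2 j <= j)%N.
Proof.
move=> m12 mm; have /andP[h _] := square_depth_bounds j m12 mm.
rewrite -(@leq_exp2l m2) ?(leq_trans m12)//; apply: leq_trans h _.
by case: j => // j; rewrite leq_exp2r.
Qed.

Definition square_key (m1 m2 : nat) (j : nat) (w : nat -> 'I_m1 * 'I_m2) : nat * nat :=
  (digit_prefix (fun k => (w k).1) j,
   digit_prefix (fun k => (w k).2) (square_depth m1 m2 j)).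

Lemma square_keyP (m1 m2 j : nat) (w w' : nat -> 'I_m1 * 'I_m2) :
  square_key j w = square_key j w' <->
  (forall k, (k < j)%N -> (w k).1 = (w' k).1) /\
  (forall k, (k < square_depth m1 m2 j)%N -> (w k).2 = (w' k).2).
Proof.
split=> [[/digit_prefix_inj h1 /digit_prefix_inj h2]|[h1 h2]]; first by split.
by congr pair; apply/digit_prefix_inj.
Qed.

(** The sides are m1^(-j) and m2^(-L), and the maximality of L gives m2^(-L) <= m2 m1^(-j). *)
Lemma square_diam (R : realType) (m1 m2 j : nat) (w w' : nat -> 'I_m1 * 'I_m2) :
  (2 <= m1)%N -> (m1 <= m2)%N -> square_key j w = square_key j w' ->
  flat_dist (representation_map R w) (representation_map R w') <=
  (1 + m2%:R) / m1%:R ^+ j.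
Proof.
move=> m12 mm [h1 h2]; apply: le_trans (flat_dist_le _ _) _.
have m1p : (0 < m1)%N by exact: leq_trans m12.
have m2p : (0 < m2)%N by exact: leq_trans mm.
apply: le_trans (eucl_le_norm _ _) _; rewrite /= mulrDl; apply: lerD.
  have := digit_expansion_bounds R (fun k => (w k).1) j m1p.
  have := digit_expansion_bounds R (fun k => (w' k).1) j m1p.
  rewrite h1 -natr1 mulrDl ler_norml; lra.
have := digit_expansion_bounds R (fun k => (w k).2) (square_depth m1 m2 j) m2p.
have := digit_expansion_bounds R (fun k => (w' k).2) (square_depth m1 m2 j) m2p.
have /andP[_ h] := square_depth_bounds j m12 mm.
have h3 : 1 / m2%:R ^+ square_depth m1 m2 j <= m2%:R / m1%:R ^+ j :> R.
  rewrite ler_pdivrMr ?exprn_gt0 ?ltr0n// mulrAC ler_pdivlMr ?exprn_gt0 ?ltr0n//.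
  by rewrite mul1r -exprS -!natrX ler_nat ltnW.
rewrite h2 -natr1 mulrDl ler_norml; lra.
Qed.

Definition neighbour_keys (m1 m2 j : nat) (K : nat * nat) : seq (nat * nat) :=
  [seq (a, b) | a <- cyclic_neighbours (m1 ^ j) K.1,
                b <- cyclic_neighbours (m2 ^ square_depth m1 m2 j) K.2].

Lemma size_neighbour_keys m1 m2 j K : size (neighbour_keys m1 m2 j K) = 25%N.
Proof. by rewrite size_allpairs !size_map size_iota. Qed.

Lemma neighbour_keysP (R : realType) (m1 m2 j : nat) (w w' : nat -> 'I_m1 * 'I_m2) :
  (2 <= m1)%N -> (m1 <= m2)%N ->
  flat_dist (representation_map R w) (representation_map R w') <= (m1%:R ^+ j)^-1 ->
  square_key j w \in neighbour_keys m1 m2 j (square_key j w').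
Proof.
move=> m12 mm ww'.
have m1p : (0 < m1)%N by exact: leq_trans m12.
have m2p : (0 < m2)%N by exact: leq_trans mm.
have m1j : 0 < (m1%:R ^+ j)^-1 :> R by rewrite invr_gt0 exprn_gt0// ltr0n.
(* The radius is doubled to turn the large inequality into the strict one that [flat_dist_coord]
   asks for. *)
have [|z1 [z2 [h1 h2]]] := @flat_dist_coord R _ _ (2 / m1%:R ^+ j) (le_lt_trans ww' _).
  by rewrite mulrDl mul1r ltrDl.
apply/allpairsP; exists (square_key j w); split=> //=.
  apply: cyclic_neighboursP (digit_prefix_lt _ _) _ _ _; rewrite ?natrX.
  - exact: digit_expansion_bounds.
  - exact: digit_expansion_bounds.
  - exact: h1.
apply: cyclic_neighboursP (digit_prefix_lt _ _) _ _ _; rewrite ?natrX.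
- exact: digit_expansion_bounds.
- exact: digit_expansion_bounds.
(* Since m2^L <= m1^j, the same radius is at most two units of the second grid. *)
- apply: lt_le_trans h2 _.
  rewrite ler_pM2l// lef_pV2 ?posrE ?exprn_gt0 ?ltr0n// -!natrX ler_nat.
  by have /andP[] := square_depth_bounds j m12 mm.
Qed.

(** * Walks *)

Section walks.
Context {n m1 m2 : nat} (G : labelled_graph n m1 m2).

Fixpoint is_walk (i : 'I_n) (p : seq (edge G)) : bool :=
  if p is e :: p' then (source e == i) && is_walk (target e) p' else true.

(** One predicate per step, so that full labels, first letters and free steps can be mixed in a
    single count. *)
Fixpoint walks (cs : seq (pred (edge G))) (i : 'I_n) : seq (seq (edge G)) :=
  if cs is P :: cs' then
    [seq e :: p | e <- enum [pred e | (source e == i) && P e], p <- walks cs' (target e)]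
  else [:: [::]].

Lemma mem_walks cs i p :
  (p \in walks cs i) = all2 (fun (P : pred (edge G)) e => P e) cs p && is_walk i p.
Proof.
elim: cs i p => [|P cs IH] i [|e p] //=.
  by apply/negP => /allpairsPdep[e [p [_ _]]].
apply/allpairsPdep/andP => [[f [q [fP qcs [-> ->]]]]|[/andP[Pe csp] /andP[ei ep]]].
  move: qcs fP; rewrite IH mem_enum inE => /andP[-> ->] /andP[-> ->]//.
by exists e, p; split => //; rewrite ?IH ?mem_enum ?inE ?Pe ?csp ?ei ?ep.
Qed.

Lemma uniq_walks cs i : uniq (walks cs i).
Proof.
elim: cs i => [|P cs IH] i //=; apply: allpairs_uniq_dep => //.
  exact: enum_uniq.
by move=> [e p] [f q] /= _ _ [-> ->].
Qed.

Lemma size_walks P cs i :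
  size (walks (P :: cs) i) =
  (\sum_(e : edge G | (source e == i) && P e) size (walks cs (target e)))%N.
Proof. by rewrite /= size_allpairs_dep sumnE big_map big_enum. Qed.

Definition nb_walks cs : nat := (\sum_i size (walks cs i))%N.

Lemma size_walks_le cs i : (size (walks cs i) <= nb_walks cs)%N.
Proof. by rewrite /nb_walks (bigD1 i)//= leq_addr. Qed.

(* Right-resolving: a prescribed word is read along at most one walk from i. *)
Lemma size_walks_labels (ds : seq ('I_m1 * 'I_m2)) cs i :
  right_resolving G ->
  (size (walks ([seq (fun e => label e == d) | d <- ds] ++ cs) i) <= nb_walks cs)%N.
Proof.
move=> rr; elim: ds i => [|d ds IH] i; first exact: size_walks_le.
rewrite /= -/(walks _ _) -[X in (X <= _)%N]/(size (walks (_ :: _) i)) size_walks.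
have [e /andP[/eqP ei /eqP ed]|none] := pickP [pred e : edge G | (source e == i) && (label e == d)].
  rewrite (big_pred1 e)//= => f /=.
  apply/andP/eqP => [[/eqP fi /eqP fd]|-> ]; last by rewrite ei ed.
  apply: contrapT => ef; apply: (rr f e ef); first by rewrite fi.
  by rewrite fd.
by rewrite big_pred0.
Qed.

Definition letters : {set 'I_m1} := [set (label e).1 | e : edge G].

(* A step constrained to have first coordinate s (Some s) or free (None). *)
Definition allows (o : option 'I_m1) : pred (edge G) :=
  fun e => if o is Some s then (label e).1 == s else true.

Definition step_rate (R : realType) (lam : R) (o : option 'I_m1) : R :=
  if o is Some _ then lam else #|letters|%:R * lam.

(** The maps [h] and [g] stand for [source] and [target] in either order, which serves column and
    row eigenvectors alike. A free step is the sum over all letters, whence the factor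
    #|letters|. *)
Lemma step_eigen (R : realType) (lam : R) (h g : edge G -> 'I_n) (v : 'I_n -> R) :
  (forall s, s \in letters -> forall i,
     \sum_(e : edge G | (h e == i) && ((label e).1 == s)) v (g e) = lam * v i) ->
  forall o, (forall s, o = Some s -> s \in letters) -> forall i,
  \sum_(e : edge G | (h e == i) && allows o e) v (g e) = step_rate lam o * v i.
Proof.
move=> H [s|] os i; first exact/H/os.
under eq_bigl do rewrite andbT.
rewrite (partition_big (fun e => (label e).1) (mem letters)) /=; last first.
  by move=> e _; apply: imset_f.
rewrite (eq_bigr (fun=> lam * v i)); last by move=> s sl; exact: H.
by rewrite sumr_const -[LHS]mulr_natl mulrA.
Qed.

(** At an index where [v] is minimal, the positive number lam v(i) is a nonempty sum of entries that
    are all at least v(i). *)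
Lemma eigenvalue_ge1 (R : realType) (lam : R) (h g : edge G -> 'I_n)
    (v : 'I_n -> R) (s : 'I_m1) (i0 : 'I_n) :
  0 < lam -> (forall i, 0 < v i) ->
  (forall i, \sum_(e : edge G | (h e == i) && ((label e).1 == s)) v (g e) = lam * v i) ->
  1 <= lam.
Proof.
move=> l0 v0 H; case: (arg_minP (P := xpredT) v (i0 := i0) isT) => i _ imin.
rewrite -(ler_pM2r (v0 i)) mul1r -H.
have [e he|none] := pickP [pred e : edge G | (h e == i) && ((label e).1 == s)].
  rewrite (bigD1 e)//=; apply: (le_trans (imin (g e) isT)).
  by rewrite lerDl sumr_ge0// => *; rewrite ltW.
have := mulr_gt0 l0 (v0 i); rewrite -H big_pred0 ?ltxx//.
Qed.

(** The point is uniformity: one constant [C] for all lengths and all patterns of prescribed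
    letters. *)
Definition growth (R : realType) (C lam : R) : Prop :=
  forall os : seq (option 'I_m1), (forall s, Some s \in os -> s \in letters) ->
  C^-1 * \prod_(o <- os) step_rate lam o <= (nb_walks (map allows os))%:R /\
  (nb_walks (map allows os))%:R <= C * \prod_(o <- os) step_rate lam o.

Lemma vector_bounds (R : realType) (v : 'I_n -> R) (i0 : 'I_n) : (forall i, 0 < v i) ->
  exists a b : R, [/\ 0 < a, 0 < b & forall i, a <= v i <= b].
Proof.
move=> v0; case: (arg_minP (P := xpredT) v (i0 := i0) isT) => i _ imin.
case: (arg_maxP (P := xpredT) v (i0 := i0) isT) => j _ jmax.
by exists (v i), (v j); split => // k; rewrite imin//=; exact: jmax.
Qed.

Lemma step_rate_gt0 (R : realType) (lam : R) o (s0 : 'I_m1) :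
  s0 \in letters -> 0 < lam -> 0 < step_rate lam o.
Proof.
case: o => [s|] // s0l l0; rewrite /= mulr_gt0// ltr0n.
by apply/card_gt0P; exists s0.
Qed.

(** By induction on the first step, the number of walks from [i] is the product of the rates times
    v(i), up to the bounds [a] and [b] of [v]; then one sums over [i]. *)
Lemma growth_column (R : realType) (lam : R) (v : 'I_n -> R) (i0 : 'I_n) (s0 : 'I_m1) :
  s0 \in letters -> 0 < lam -> (forall i, 0 < v i) ->
  (forall s, s \in letters -> forall i,
     \sum_(e : edge G | (source e == i) && ((label e).1 == s)) v (target e) = lam * v i) ->
  exists2 C : R, 0 < C & growth C lam.
Proof.
move=> s0l l0 v0 H; have [a [b [a0 b0 ab]]] := vector_bounds i0 v0.
have sumv0 : 0 < \sum_i v i.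
  by rewrite (bigD1 i0)//= ltr_pwDl// sumr_ge0// => *; exact: ltW.
pose S := \sum_i v i.
have key os : (forall s, Some s \in os -> s \in letters) -> forall i,
    b^-1 * \prod_(o <- os) step_rate lam o * v i <= (size (walks (map allows os) i))%:R /\
    (size (walks (map allows os) i))%:R <= a^-1 * \prod_(o <- os) step_rate lam o * v i.
  elim: os => [_|o os IH osl] i.
    rewrite big_nil !mulr1; have /andP[ai ib] := ab i; split.
      by rewrite mulrC ler_pdivrMr// mul1r.
    by rewrite mulrC ler_pdivlMr// mul1r.
  have ol s : o = Some s -> s \in letters by move=> E; apply: osl; rewrite E mem_head.
  have osl' s : Some s \in os -> s \in letters by move=> sos; apply: osl; rewrite inE sos orbT.
  have {}IH := IH osl'.
  have E := step_eigen H ol.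
  rewrite [map _ _]/= size_walks natr_sum big_cons.
  have Ec c : c * (step_rate lam o * \prod_(o <- os) step_rate lam o) * v i =
     \sum_(e : edge G | (source e == i) && allows o e) c * \prod_(o <- os) step_rate lam o * v (target e).
    by rewrite -mulr_sumr E; ring.
  by rewrite !Ec; split; apply: ler_sum => e _; have [] := IH (target e).
pose C := maxr (b * S^-1) (a^-1 * S).
have C0 : 0 < C by rewrite lt_max mulr_gt0// invr_gt0.
exists C => // os osl.
have p0 : 0 < \prod_(o <- os) step_rate lam o.
  by rewrite prodr_gt0// => o _; exact: step_rate_gt0 s0l l0.
rewrite /nb_walks natr_sum; split.
  apply: (@le_trans _ _ (\sum_i b^-1 * \prod_(o <- os) step_rate lam o * v i)).
    rewrite -mulr_sumr mulrAC ler_pM2r// -[leRHS]invrK lef_pV2 ?posrE ?invr_gt0 ?mulr_gt0 ?invr_gt0//.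
    by rewrite invfM invrK le_max lexx.
  by apply: ler_sum => i _; have [] := key os osl i.
apply: (@le_trans _ _ (\sum_i a^-1 * \prod_(o <- os) step_rate lam o * v i)).
  by apply: ler_sum => i _; have [] := key os osl i.
by rewrite -mulr_sumr mulrAC ler_pM2r// le_max lexx orbT.
Qed.

(** Weighting starting vertices by [v] makes the count exact: prepending a step multiplies the
    weighted sum by its rate. The weights are then removed with [a <= v i <= b]. *)
Lemma growth_row (R : realType) (lam : R) (v : 'I_n -> R) (i0 : 'I_n) (s0 : 'I_m1) :
  s0 \in letters -> 0 < lam -> (forall i, 0 < v i) ->
  (forall s, s \in letters -> forall i,
     \sum_(e : edge G | (target e == i) && ((label e).1 == s)) v (source e) = lam * v i) ->
  exists2 C : R, 0 < C & growth C lam.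
Proof.
move=> s0l l0 v0 H; have [a [b [a0 b0 ab]]] := vector_bounds i0 v0.
pose S := \sum_i v i.
have sumv0 : 0 < S.
  by rewrite /S (bigD1 i0)//= ltr_pwDl// sumr_ge0// => *; exact: ltW.
have key os : (forall s, Some s \in os -> s \in letters) ->
    \sum_i v i * (size (walks (map allows os) i))%:R = \prod_(o <- os) step_rate lam o * S.
  elim: os => [_|o os IH osl].
    by rewrite big_nil mul1r; apply: eq_bigr => i _; rewrite mulr1.
  have ol s : o = Some s -> s \in letters by move=> E; apply: osl; rewrite E mem_head.
  have osl' s : Some s \in os -> s \in letters by move=> sos; apply: osl; rewrite inE sos orbT.
  have {}IH := IH osl'.
  have E := step_eigen H ol.
  rewrite big_cons -mulrA -IH mulr_sumr.
  under [RHS]eq_bigr => j _ do rewrite mulrA -E mulr_suml.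
  under [LHS]eq_bigr => j _ do rewrite [map _ _]/= size_walks natr_sum mulr_sumr.
  rewrite (exchange_big_dep (allows o))/=; last by move=> i e _ /andP[].
  rewrite [RHS](exchange_big_dep (allows o))/=; last by move=> i e _ /andP[].
  apply: eq_bigr => e oe.
  rewrite (big_pred1 (source e)); last by move=> i; rewrite oe andbT eq_sym.
  by rewrite (big_pred1 (target e)) // => i; rewrite oe andbT eq_sym.
pose C := maxr (b * S^-1) (a^-1 * S).
have C0 : 0 < C by rewrite lt_max mulr_gt0// invr_gt0.
exists C => // os osl.
have p0 : 0 < \prod_(o <- os) step_rate lam o.
  by rewrite prodr_gt0// => o _; exact: step_rate_gt0 s0l l0.
rewrite /nb_walks natr_sum; split.
  apply: (@le_trans _ _ (b^-1 * (\prod_(o <- os) step_rate lam o * S))).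
    rewrite mulrCA [leLHS]mulrC ler_pM2l// -[leRHS]invrK lef_pV2 ?posrE ?invr_gt0 ?mulr_gt0 ?invr_gt0//.
    by rewrite invfM invrK le_max lexx.
  rewrite -key// mulrC ler_pdivrMr// mulr_suml; apply: ler_sum => i _.
  by rewrite mulrC ler_wpM2l//; have /andP[] := ab i.
apply: (@le_trans _ _ (a^-1 * (\prod_(o <- os) step_rate lam o * S))).
  rewrite -key// mulrC ler_pdivlMr// mulr_suml; apply: ler_sum => i _.
  by rewrite mulrC ler_wpM2r//; have /andP[] := ab i.
by rewrite mulrCA mulrC ler_pM2r// le_max lexx orbT.
Qed.

End walks.

(** * Compactness of the space of infinite paths *)

Section infinite_walks.
Context {n m1 m2 : nat} (G : labelled_graph n m1 m2).

(** Each [B k] is decided by the first [j k] edges, hence open. Without a finite subcover, finite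
    words that no finite subfamily covers extend edge by edge to an infinite path outside every
    [B k]. *)
Lemma konig (j : nat -> nat) (B : nat -> (nat -> edge G) -> Prop) :
  (forall k p p', (forall i, (i < j k)%N -> p i = p' i) -> B k p -> B k p') ->
  (forall p, infinite_path p -> exists k, B k p) ->
  exists K, forall p, infinite_path p -> exists2 k, (k < K)%N & B k p.
Proof.
move=> Bj cov; apply: contrapT => noK.
pose good (l : seq (edge G)) := forall K, exists2 p : nat -> edge G,
  infinite_path p /\ mkseq p (size l) = l & forall k, (k < K)%N -> ~ B k p.
have good0 : good [::].
  move=> K; apply: contrapT => H; apply: noK; exists K => p ip.
  by apply: contrapT => H'; apply: H; exists p => // k kK Bk; apply: H'; exists k.
have good_rcons l : good l -> exists e, good (rcons l e).
  move=> gl; apply: contrapT => H.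
  (* If no edge extended [l], each edge [e] would have a bound [K e], and their maximum over the
     finitely many edges would contradict that [l] is good. *)
  have /choice[K KP] e : exists K, forall p : nat -> edge G, infinite_path p ->
      mkseq p (size l).+1 = rcons l e -> exists2 k, (k < K)%N & B k p.
    apply: contrapT => He; apply: H; exists e => K.
    apply: contrapT => HK; apply: He; exists K => p ip pl.
    apply: contrapT => H'; apply: HK; exists p; first by rewrite size_rcons.
    by move=> k kK Bk; apply: H'; exists k.
  have [p [ip pl] pB] := gl (\max_(e : edge G) K e)%N.
  have [||k kK Bk] := KP (p (size l)) p; [by []| |].
    by rewrite mkseqS pl.
  by apply: (pB k) Bk; apply: leq_trans kK _; exact: leq_bigmax.
have [p0 _ _] := good0 0%N.
have /choice[g gP] l : exists e, good l -> good (rcons l e).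
  have [/good_rcons[e ge]|ngl] := pselect (good l); first by exists e.
  by exists (p0 0%N).
pose f k := iter k (fun l => rcons l (g l)) [::].
have fgood k : good (f k) by elim: k => //= k /gP.
pose w k := g (f k).
have fw k : mkseq w k = f k by elim: k => // k IH; rewrite mkseqS IH.
have wagree N K : exists2 p : nat -> edge G,
    infinite_path p /\ (forall i, (i < N)%N -> p i = w i) & forall k, (k < K)%N -> ~ B k p.
  have [p [ip]] := fgood N K; rewrite -fw size_mkseq => pw pB.
  exists p => //; split => // i iN.
  by rewrite -(nth_mkseq (p0 0%N) p iN) pw nth_mkseq.
have iw : infinite_path w.
  move=> k; have [p [ip pw] _] := wagree k.+2 0%N.
  by rewrite -!pw.
have [k Bk] := cov w iw.
(* This [p] shares with [w] the edges that decide [B k], yet avoids [B k]. *)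
have [p [ip pw] pB] := wagree (j k) k.+1.
apply: (pB k) => //; apply: Bj Bk => i ij; by rewrite pw.
Qed.

Lemma all2_nth (S T : Type) (r : S -> T -> bool) (x0 : S) (y0 : T) s t :
  size s = size t -> (forall k, (k < size s)%N -> r (nth x0 s k) (nth y0 t k)) ->
  all2 r s t.
Proof.
elim: s t => [|x s IH] [|y t] //= [st] H; rewrite (H 0%N)//=.
by apply: IH => // k ks; exact: (H k.+1).
Qed.

Lemma size_le_sum_count (T I : eqType) (s : seq T) (r : seq I) (D : pred I)
    (P : I -> pred T) :
  (forall x, x \in s -> exists2 k, k \in r & D k && P k x) ->
  (size s <= \sum_(k <- r | D k) count (P k) s)%N.
Proof.
elim: s => [|x s IH] H //=; rewrite big_split/= -add1n leq_add//; last first.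
  by apply: IH => y ys; apply: H; rewrite inE ys orbT.
have [k kr /andP[Dk Pk]] := H x (mem_head _ _).
by rewrite (big_rem k)//= Dk Pk.
Qed.

(** * Counting walks in approximate squares *)

Variable out : 'I_n -> edge G.
Hypothesis source_out : forall i, source (out i) = i.

(** Once [p] is exhausted the path follows [out] forever; thus finite walks have keys at every
    level. *)
Fixpoint extend (p : seq (edge G)) (i : 'I_n) (k : nat) : edge G :=
  match k, p with
  | 0%N, [::] => out i
  | 0%N, e :: _ => e
  | k'.+1, [::] => extend [::] (target (out i)) k'
  | k'.+1, e :: p' => extend p' (target e) k'
  end.

Lemma source_extend p i : is_walk i p -> source (extend p i 0) = i.
Proof. by case: p => [|e p] //= /andP[/eqP]. Qed.

Lemma infinite_extend p i : is_walk i p -> infinite_path (extend p i).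
Proof.
move=> ip k; elim: k p i ip => [|k IH] [|e p] i /=.
- by rewrite source_out.
- by move=> /andP[_ /source_extend].
- by move=> _; exact: IH.
- by move=> /andP[_]; exact: IH.
Qed.

Lemma nth_extend e0 p i k : (k < size p)%N -> extend p i k = nth e0 p k.
Proof. by elim: p i k => [|e p IH] i [|k] //=; rewrite ltnS => /IH. Qed.

Variables (R : realType) (C lam : R).
Hypotheses (m1_ge2 : (2 <= m1)%N) (m1_le_m2 : (m1 <= m2)%N).
Variable i0 : 'I_n.
Hypothesis rr : right_resolving G.
Hypotheses (C0 : 0 < C) (lam0 : 0 < lam) (gr : growth G C lam).

Let q : R := #|letters G|%:R.
Let word_of (p : nat -> edge G) k := label (p k).

Lemma letters_mem (e : edge G) : (label e).1 \in letters G.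
Proof. exact: imset_f. Qed.

Lemma prod_step_rate (T : Type) (f : T -> 'I_m1) (s : seq T) N :
  \prod_(o <- [seq Some (f k) | k <- s] ++ nseq N None) step_rate G lam o =
  lam ^+ size s * (q * lam) ^+ N.
Proof.
rewrite big_cat big_map big_nseq /= iter_mulr_1; congr (_ * _).
by rewrite big_const_seq count_predT iter_mulr_1.
Qed.

(** All walks in the square share with one of them, [p0], the full labels on L steps and the first
    letters on the next j - L steps. Right-resolving makes the first block cost nothing, and
    [growth] counts the rest. *)
Lemma count_square (i : 'I_n) (j N : nat) (K : nat * nat) : (j <= N)%N ->
  (count (fun p => square_key j (word_of (extend p i)) == K)
     (walks (map (@allows _ _ _ G) (nseq N None)) i))%:R <=
  C * (lam ^+ (j - square_depth m1 m2 j) * (q * lam) ^+ (N - j)).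
Proof.
move=> jN; set S := walks _ i; set P := (fun p => _).
have qlam0 : 0 <= q * lam by rewrite mulr_ge0// ltW.
have [/hasP[p0 p0S /eqP p0K]|] := boolP (has P S); last first.
  rewrite has_count -eqn0Ngt => /eqP ->.
  by rewrite mulr_ge0 ?mulr_ge0 ?exprn_ge0// ltW.
set L := square_depth m1 m2 j.
have Lj : (L <= j)%N by exact: square_depth_le.
pose x := extend p0 i.
pose ds := [seq label (x k) | k <- iota 0 L].
pose os := [seq Some (label (x k)).1 | k <- iota L (j - L)] ++ nseq (N - j) None.
pose cs := [seq (fun e : edge G => label e == d) | d <- ds] ++ map (@allows _ _ _ G) os.
have scs : size cs = N.
  by rewrite size_cat !size_map size_iota size_cat size_map size_iota size_nseq; lia.
apply: (@le_trans _ _ (nb_walks (map (@allows _ _ _ G) os))%:R); last first.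
  have [|_ /le_trans] := gr (os := os).
    move=> s; rewrite mem_cat => /orP[/mapP[k _ [->]]|]; first exact: letters_mem.
    by rewrite mem_nseq andbF.
  by apply; rewrite prod_step_rate size_iota.
rewrite ler_nat; apply: leq_trans (size_walks_labels ds _ i rr).
rewrite -size_filter -/cs; apply: uniq_leq_size; first by rewrite filter_uniq// uniq_walks.
move=> p; rewrite mem_filter mem_walks => /andP[/eqP pK].
rewrite mem_walks => /andP[pN ->]; rewrite andbT.
have sp : size p = N.
  by move: pN; rewrite all2E size_map size_nseq => /andP[/eqP].
move: pK; rewrite -p0K => /square_keyP[h1 h2].
have e0 : edge G := out i.
apply: (all2_nth (x0 := xpredT) (y0 := e0)); first by rewrite scs sp.
rewrite scs => k kN; rewrite -(nth_extend e0 i) ?sp//.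
rewrite /cs nth_cat size_map size_map size_iota; case: ltnP => [kL|Lk].
  rewrite (nth_map (label e0)) ?size_map ?size_iota//.
  rewrite (nth_map 0%N) ?size_iota// nth_iota// add0n.
  have := h1 k (leq_trans kL Lj); have := h2 k kL; rewrite /word_of -/x.
  by case: (label _) => a b; case: (label _) => c d /= -> ->.
rewrite (nth_map None); last first.
  by rewrite size_cat size_map size_iota size_nseq; lia.
rewrite nth_cat size_map size_iota; case: ltnP => [kj|jk]; last first.
  by rewrite nth_nseq if_same.
rewrite (nth_map 0%N) ?size_iota// nth_iota// /allows subnKC//.
by apply/eqP; apply: h1; lia.
Qed.

(** The walks of a length [N] beyond all levels number at least (q lam)^N / C, and each square holds
    at most its share by [count_square]; comparing the two counts gives the bound. *)
Lemma cover_count (J : nat -> nat) (D : pred nat) (l : nat -> seq (nat * nat)) (K M : nat) :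
  (forall k, D k -> (size (l k) <= M)%N) ->
  (forall p : nat -> edge G, infinite_path p -> exists2 k, (k < K)%N &
     D k && (square_key (J k) (word_of p) \in l k)) ->
  1 <= n%:R * M%:R * C ^+ 2 *
  \sum_(0 <= k < K | D k) (lam ^+ square_depth m1 m2 (J k) * q ^+ J k)^-1.
Proof.
move=> lM cov.
pose N := (\max_(k < K) J k)%N.
have JN k : (k < K)%N -> (J k <= N)%N.
  by move=> kK; exact: (leq_bigmax (Ordinal kK)).
set Sig := \sum_(0 <= k < K | _) _.
pose S i := walks (map (@allows _ _ _ G) (nseq N None)) i.
have q0 : 0 < q.
  by rewrite ltr0n; apply/card_gt0P; exists (label (out i0)).1; exact: letters_mem.
have sizeS i : (size (S i))%:R <= M%:R * C * (q * lam) ^+ N * Sig.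
  have Scov p : p \in S i -> exists2 k, k \in index_iota 0 K &
      D k && (square_key (J k) (word_of (extend p i)) \in l k).
    rewrite mem_walks => /andP[_ /infinite_extend/cov[k kK Dk]].
    by exists k => //; rewrite mem_index_iota.
  apply: le_trans (_ : (\sum_(0 <= k < K | D k) \sum_(Q <- l k)
    count (fun p => square_key (J k) (word_of (extend p i)) == Q) (S i))%:R <= _).
    rewrite ler_nat; apply: leq_trans (size_le_sum_count Scov) _.
    apply: leq_sum => k Dk; rewrite -size_filter.
    (* A second union bound, now over the keys listed in [l k]. *)
    have := @size_le_sum_count _ _ [seq p <- S i | square_key (J k) (word_of (extend p i)) \in l k]
      (l k) xpredT (fun Q p => square_key (J k) (word_of (extend p i)) == Q).
    move=> /(_ _)/leq_trans; apply.
      move=> p; rewrite mem_filter => /andP[pl _].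
      by exists (square_key (J k) (word_of (extend p i))) => /=.
    by apply: leq_sum => Q _; rewrite count_filter; apply: sub_count => p /andP[].
  rewrite natr_sum mulr_sumr; rewrite big_nat_cond [leRHS]big_nat_cond.
  apply: ler_sum => k /andP[/andP[_ kK] Dk].
  have Lj := square_depth_le (J k) m1_ge2 m1_le_m2.
  have E : lam ^+ (J k - square_depth m1 m2 (J k)) * (q * lam) ^+ (N - J k) =
     (q * lam) ^+ N * (lam ^+ square_depth m1 m2 (J k) * q ^+ J k)^-1.
    apply: (canRL (mulfK _)).
      by rewrite mulf_neq0// expf_neq0// gt_eqF// q0.
    rewrite !exprMn.
    have -> : q ^+ N = q ^+ (N - J k) * q ^+ J k by rewrite -exprD subnK ?JN.
    have -> : lam ^+ N = lam ^+ (J k - square_depth m1 m2 (J k)) * lam ^+ (N - J k) *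
        lam ^+ square_depth m1 m2 (J k).
      by rewrite -!exprD; congr (_ ^+ _); have := JN k kK; lia.
    by ring.
  rewrite natr_sum.
  apply: (@le_trans _ _ (\sum_(Q <- l k) C * ((q * lam) ^+ N *
      (lam ^+ square_depth m1 m2 (J k) * q ^+ J k)^-1))).
    by apply: ler_sum => Q _; rewrite -E; apply: count_square; exact: JN.
  rewrite big_const_seq count_predT iter_addr_0 -[leLHS]mulr_natl -!mulrA.
  rewrite ler_wpM2r ?ler_nat ?lM// ?mulr_ge0 ?invr_ge0 ?mulr_ge0 ?exprn_ge0 ?mulr_ge0// ltW//.
have [|+ _] := gr (os := nseq N None); first by move=> s; rewrite mem_nseq andbF.
rewrite big_nseq iter_mulr_1 /= -/q => lower.
have qN : 0 < (q * lam) ^+ N by rewrite exprn_gt0// mulr_gt0.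
have {lower} : C^-1 * (q * lam) ^+ N <= n%:R * (M%:R * C * (q * lam) ^+ N * Sig).
  apply: le_trans lower _; rewrite /nb_walks natr_sum.
  apply: le_trans (ler_sum (G := fun=> M%:R * C * (q * lam) ^+ N * Sig) _ _) _.
    by move=> i _; exact: sizeS.
  by rewrite sumr_const card_ord -[leLHS]mulr_natl.
move=> /(ler_wpM2r (ltW (divr_gt0 C0 qN))).
rewrite -/q mulrACA mulVf ?gt_eqF// divff ?gt_eqF// mul1r.
move=> /le_trans; apply; rewrite le_eqVlt; apply/orP; left; apply/eqP.
by field; rewrite !gt_eqF.
Qed.

Fixpoint letter_words (r : nat) : seq (seq 'I_m1) :=
  if r is r'.+1 then [seq s :: u | s <- enum (letters G), u <- letter_words r']
  else [:: [::]].

Lemma size_letter_words r : size (letter_words r) = (#|letters G| ^ r)%N.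
Proof. by elim: r => [|r IH] //=; rewrite size_allpairs IH -cardE expnS. Qed.

Lemma mem_letter_words (p : nat -> edge G) (s : seq nat) :
  [seq (label (p k)).1 | k <- s] \in letter_words (size s).
Proof.
elim: s => [|k s IH] //=; apply/allpairsP.
by exists ((label (p k)).1, [seq (label (p k)).1 | k <- s]); rewrite mem_enum letters_mem.
Qed.

Lemma is_walk_mkseq (p : nat -> edge G) a r : infinite_path p ->
  is_walk (source (p a)) [seq p k | k <- iota a r].
Proof.
by move=> ip; elim: r a => [|r IH] a //=; rewrite eqxx ip IH.
Qed.

(** The pieces are indexed by a walk of length L and the first letters of the next j - L steps, so
    that their number is at most C (q lam)^L q^(j - L) = C lam^L q^j. *)
Lemma cover_squares (j : nat) : exists N (U : 'I_N -> set (torus R)),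
  [/\ sofic_set R G `<=` \bigcup_i U i,
      forall i, (diam (U i) <= ((1 + m2%:R) / m1%:R ^+ j)%:E)%E &
      N%:R <= C * (lam ^+ square_depth m1 m2 j * q ^+ j)].
Proof.
set L := square_depth m1 m2 j; have Lj : (L <= j)%N by exact: square_depth_le.
pose any := map (@allows _ _ _ G) (nseq L None).
pose W := [seq (p, u) | p <- flatten [seq walks any i | i <- enum 'I_n],
                        u <- letter_words (j - L)].
pose V (pu : seq (edge G) * seq 'I_m1) := [set representation_map R (word_of x) |
  x in [set x : nat -> edge G | [/\ infinite_path x, [seq x k | k <- iota 0 L] = pu.1 &
          [seq (label (x k)).1 | k <- iota L (j - L)] = pu.2]]].
exists (size W), (fun i => V (tnth (in_tuple W) i)); split.
- move=> _ [w [x ix xw] <-].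
  have xW : ([seq x k | k <- iota 0 L], [seq (label (x k)).1 | k <- iota L (j - L)]) \in W.
    apply/allpairsP; exists ([seq x k | k <- iota 0 L], [seq (label (x k)).1 | k <- iota L (j - L)]).
    split => //=; last by have := mem_letter_words x (iota L (j - L)); rewrite size_iota.
    apply/flattenP; exists (walks any (source (x 0%N))).
      by apply/mapP; exists (source (x 0%N)) => //; rewrite mem_enum.
    rewrite mem_walks is_walk_mkseq// andbT.
    by rewrite /any; elim: (L) 0%N => //= r IH a; rewrite IH.
  have /tnthP[i xi] : ([seq x k | k <- iota 0 L], [seq (label (x k)).1 | k <- iota L (j - L)])
    \in in_tuple W by [].
  exists i => //; rewrite -xi; exists x => //=.
  by congr representation_map; apply/funext => k; rewrite xw.
- move=> i; apply: diam_le; first by rewrite divr_ge0 ?addr_ge0 ?exprn_ge0.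
  move=> _ _ [x [_ x1 x2] <-] [y [_ y1 y2] <-]; apply: square_diam => //.
  have xy1 k : (k < L)%N -> x k = y k.
    move=> kL; have := congr1 (fun s => nth (x k) s k) (etrans x1 (esym y1)).
    by rewrite !(nth_map 0%N) ?size_iota// nth_iota.
  apply/square_keyP; split => k kj; last by rewrite /word_of xy1.
  have [kL|Lk] := ltnP k L; first by rewrite /word_of xy1.
  have := congr1 (fun s => nth (label (x k)).1 s (k - L)) (etrans x2 (esym y2)).
  have kL : (k - L < j - L)%N by lia.
  by rewrite !(nth_map 0%N) ?size_iota// !nth_iota// subnKC.
have -> : size W = (nb_walks any * #|letters G| ^ (j - L))%N.
  rewrite size_allpairs size_letter_words size_flatten /shape -map_comp.
  by rewrite sumnE big_map big_enum.
have [|_ +] := gr (os := nseq L None); first by move=> s; rewrite mem_nseq andbF.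
rewrite big_nseq iter_mulr_1 /= natrM natrX -/q => upper.
apply: le_trans (ler_wpM2r _ upper) _; first by rewrite exprn_ge0.
rewrite exprMn -[in leRHS](subnK Lj) exprD.
by rewrite le_eqVlt; apply/orP; left; apply/eqP; ring.
Qed.
End infinite_walks.

(** * The exponent, and auxiliary facts on matrices and powers *)

Lemma powR_log (R : realType) (a x : R) : 1 < a -> 0 < x -> a `^ (ln x / ln a) = x.
Proof.
move=> a1 x0; have a0 : 0 < a by exact: lt_trans a1.
by rewrite /powR gt_eqF// divfK ?lnK// gt_eqF// ln_gt0.
Qed.

Lemma inv_powR (R : realType) (a x : R) : 0 <= a -> a^-1 `^ x = a `^ (- x).
Proof. by move=> a0; rewrite -powR_inv1// -powRrM mulN1r. Qed.

(** The first summand of [t] turns m1^j into q^j exactly. The second turns powers of m2 into powers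
    of [lam], and m1^j lies between m2^L and m2^(L + 1), which costs one factor [lam]. *)
Lemma rate_bounds (R : realType) (m1 m2 : nat) (q lam : R) (j : nat) :
  (2 <= m1)%N -> (m1 <= m2)%N -> 1 <= q -> 1 <= lam ->
  let t := ln q / ln m1%:R + ln lam / ln m2%:R in
  lam ^+ square_depth m1 m2 j * q ^+ j <= (m1%:R ^+ j) `^ t /\
  (m1%:R ^+ j) `^ t <= lam * (lam ^+ square_depth m1 m2 j * q ^+ j).
Proof.
move=> m12 mm q1 l1 t; set L := square_depth m1 m2 j.
have m1R : 1 < m1%:R :> R by rewrite ltr1n.
have m2R : 1 < m2%:R :> R by rewrite ltr1n (leq_trans m12).
have q0 : 0 < q by exact: lt_le_trans q1.
have l0 : 0 < lam by exact: lt_le_trans l1.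
have powX (a x : R) k : 1 < a -> 0 < x -> (a ^+ k) `^ (ln x / ln a) = x ^+ k.
  move=> a1 x0; have a0 := lt_trans ltr01 a1.
  by rewrite -powR_mulrn ?ltW// powRAC powR_log// powR_mulrn// ltW.
have b0 : 0 <= ln lam / ln m2%:R by rewrite divr_ge0// ln_ge0// ltW.
rewrite /t powRD; last by apply/implyP => _; rewrite expf_neq0// gt_eqF// (lt_trans _ m1R).
rewrite powX// mulrC; have /andP[h1 h2] := square_depth_bounds j m12 mm.
rewrite ler_pM2l ?exprn_gt0// mulrCA ler_pM2l ?exprn_gt0// -exprS.
rewrite -!(powX m2%:R lam)//; split; apply: ge0_ler_powR => //;
  rewrite ?nnegrE ?exprn_ge0// -!natrX ler_nat//.
exact: ltnW.
Qed.

Lemma sum_target_card (R : realType) (T I : finType) (P : pred T) (f : T -> I) (v : I -> R) :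
  \sum_(e | P e) v (f e) = \sum_j #|[set e | P e && (f e == j)]%SET|%:R * v j.
Proof.
rewrite (partition_big f xpredT)//=; apply: eq_bigr => j _.
rewrite (eq_bigr (fun=> v j)); last by move=> e /andP[_ /eqP ->].
by rewrite sumr_const cardsE -[LHS]mulr_natl.
Qed.

(** A vertex without outgoing edge has a zero row in the adjacency matrix, hence in all its positive
    powers. *)
Lemma primitive_out (R : realType) (n m1 m2 : nat) (G : labelled_graph n m1 m2) i :
  primitive_mx (adjacency_mx G R) -> exists e : edge G, source e = i.
Proof.
case=> [[//|k] _ Ak]; apply: contrapT => no; have := Ak i i.
rewrite exprS -mulmxE mxE big1 ?ltxx// => l _; rewrite mxE.
rewrite (_ : [set e | _]%SET = finset.set0) ?cards0 ?mul0r//.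
apply/setP => e; rewrite !inE; apply/negP => /andP[/eqP ei _].
by apply: no; exists e.
Qed.

Lemma bracket_power (R : realType) (m : nat) (x : R) : (1 < m)%N ->
  exists2 j, x <= m%:R ^+ j & forall i, (i < j)%N -> m%:R ^+ i < x.
Proof.
move=> m1; have ex : exists j, x <= m%:R ^+ j.
  exists (Num.bound x); apply: ltW; apply: le_lt_trans (ler_norm _) _.
  apply: lt_trans (archi_boundP (normr_ge0 x)) _.
  by rewrite /Num.bound normr_id -natrX ltr_nat ltn_expl.
case: (ex_minnP ex) => j xj jmin; exists j => // i ij.
by rewrite ltNge; apply/negP => /jmin; rewrite leqNgt ij.
Qed.

(** * The mass bound and the coverings of the sofic set *)

Section dimension.
Context {n m1 m2 : nat} (G : labelled_graph n m1 m2) (out : 'I_n -> edge G).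
Context (R : realType) (C lam : R) (i0 : 'I_n).
Hypothesis source_out : forall i, source (out i) = i.
Hypotheses (m1_ge2 : (2 <= m1)%N) (m1_le_m2 : (m1 <= m2)%N).
Hypothesis rr : right_resolving G.
Hypotheses (C0 : 0 < C) (lam_ge1 : 1 <= lam) (gr : growth G C lam).

Let q : R := #|letters G|%:R.
Let t : R := ln q / ln m1%:R + ln lam / ln m2%:R.

Let q_ge1 : 1 <= q.
Proof. by rewrite ler1n; apply/card_gt0P; exists (label (out i0)).1; exact: letters_mem. Qed.

Let m1_gt1 : 1 < m1%:R :> R. Proof. by rewrite ltr1n. Qed.
Let m1_gt0 : 0 < m1%:R :> R. Proof. exact: lt_trans m1_gt1. Qed.
Let m2_gt1 : 1 < m2%:R :> R. Proof. by rewrite ltr1n (leq_trans m1_ge2). Qed.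
Let lam_gt0 : 0 < lam. Proof. exact: lt_le_trans lam_ge1. Qed.

Lemma exponent_ge0 : 0 <= t.
Proof. by rewrite addr_ge0// divr_ge0// ln_ge0// ltW. Qed.

Lemma sofic_mass_bound :
  mass_bound (sofic_set R G) (n%:R * 25%:R * C ^+ 2 * (lam * m1%:R `^ t))^-1 t.
Proof.
move=> D U d dP Ud XU.
have m1t : 0 < m1%:R `^ t by exact: powR_gt0.
have /choice[f fP] k : exists Jl : nat * seq (nat * nat), D k ->
    [/\ (m1%:R ^+ Jl.1)^-1 <= m1%:R * d k, (size Jl.2 <= 25)%N &
      forall p : nat -> edge G, infinite_path p -> U k (representation_map R (fun k => label (p k))) ->
        square_key Jl.1 (fun k => label (p k)) \in Jl.2].
  have [Dk|nDk] := pselect (D k); last by exists (0%N, [::]).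
  have /andP[d0 d1] := dP k Dk.
  (* The level used is [j.-1], where m1^(-level) lies between [d k] and m1 times [d k]; for [j = 0]
     the truncated predecessor is harmless because [d k <= 1]. *)
  have [j h1 h2] := bracket_power (d k)^-1 m1_ge2.
  have mj0 : 0 < m1%:R ^+ j.-1 :> R by exact: exprn_gt0.
  have jd : d k <= (m1%:R ^+ j.-1)^-1.
    rewrite -[leLHS]invrK lef_pV2 ?posrE ?invr_gt0//.
    case: j h2 {h1 mj0} => [_|j h2]; last by apply: ltW; exact: h2.
    by rewrite expr0 -invr1 lef_pV2 ?posrE.
  have dj : (m1%:R ^+ j.-1)^-1 <= m1%:R * d k.
    rewrite -[leRHS]invrK lef_pV2 ?posrE ?invr_gt0 ?mulr_gt0//.
    rewrite invfM mulrC ler_pdivrMr// -exprSr; apply: le_trans h1 _.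
    by case: j {h2 mj0 jd} => [|j] //=; rewrite expr0 expr1 ltW.
  (* If [U k] meets the sofic set, the keys around one common point [p0] suffice; otherwise the
     empty list does. *)
  have [[p0 [ip0 Up0]]|no] := pselect (exists p : nat -> edge G, infinite_path p /\
      U k (representation_map R (fun k => label (p k)))); last first.
    by exists (j.-1, [::]) => _; split => // p ip Up; case: no; exists p.
  exists (j.-1, neighbour_keys m1 m2 j.-1 (square_key j.-1 (fun k => label (p0 k)))) => _.
  split; [exact: dj|exact: eq_leq (size_neighbour_keys _ _ _ _)|].
  move=> p ip Up; apply: (neighbour_keysP (R := R)) => //.
  by apply: le_trans jd; apply: mdist_le_diam (Ud k Dk) _ _.
have [] := @konig _ _ _ G (fun k => (f k).1) (fun k p => D k /\
    square_key (f k).1 (fun i => label (p i)) \in (f k).2).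
- move=> k p p' pp' [Dk kp]; split => //; move: kp.
  suff -> : square_key (f k).1 (fun i => label (p i)) =
      square_key (f k).1 (fun i => label (p' i)) by [].
  apply/square_keyP; split => i ij; rewrite pp'//.
  by apply: leq_trans ij _; exact: square_depth_le.
- move=> p ip; have [|k Dk Uk] := XU (representation_map R (fun k => label (p k))).
    by exists (fun k => label (p k)) => //; exists p.
  by exists k; split => //; have [_ _] := fP k Dk; exact.
move=> K KP; exists K.
have M0 : 0 < n%:R * 25%:R * C ^+ 2 :> R.
  by rewrite !mulr_gt0 ?exprn_gt0 ?ltr0n//; exact: leq_ltn_trans (ltn_ord i0).
rewrite invfM ler_pdivrMr ?mulr_gt0// -[leLHS]mulr1 ler_pdivrMl//.
apply: le_trans (cover_count (J := fun k => (f k).1) (D := D) (l := fun k => (f k).2)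
  (K := K) (M := 25) source_out m1_ge2 m1_le_m2 i0 rr C0 lam_gt0 gr _ _) _.
- by move=> k Dk; have [] := fP k Dk.
- by move=> p /KP[k kK [Dk kp]]; exists k => //; rewrite Dk.
rewrite ler_pM2l// mulr_suml; apply: ler_sum => k Dk.
have /andP[d0 d1] := dP k Dk; have [fd _ _] := fP k Dk.
have [_ h] := rate_bounds (f k).1 m1_ge2 m1_le_m2 q_ge1 lam_ge1.
have Pos : 0 < lam ^+ square_depth m1 m2 (f k).1 * q ^+ (f k).1.
  by rewrite mulr_gt0// exprn_gt0// (lt_le_trans _ q_ge1).
have mt : 0 < (m1%:R ^+ (f k).1) `^ t by rewrite powR_gt0// exprn_gt0.
(* One factor [lam] pays for rounding the depth of the square, and one factor m1^t for rounding
   [d k] to a power of m1. *)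
apply: (@le_trans _ _ (lam * ((m1%:R ^+ (f k).1)^-1) `^ t)).
  rewrite inv_powR; last by rewrite exprn_ge0// ltW.
  rewrite powRN ler_pdivlMr//.
  by rewrite ler_pdivrMl// mulrC.
rewrite [leRHS]mulrCA ler_pM2l//.
rewrite -powRM; [|exact: ltW|exact: ltW].
apply: ge0_ler_powR => //; first exact: exponent_ge0.
- by rewrite nnegrE invr_ge0 exprn_ge0// ltW.
- by rewrite nnegrE mulr_ge0// ltW.
- by rewrite mulrC.
Qed.

Lemma sofic_covering (eps : R) : 0 < eps -> eps < 1 ->
  exists N (U : 'I_N -> set (torus R)), [/\ sofic_set R G `<=` \bigcup_i U i,
    forall i, (diam (U i) <= eps%:E)%E &
    N%:R <= C * (m1%:R * (1 + m2%:R)) `^ t * eps `^ (- t)].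
Proof.
move=> e0 e1; have m2p : 0 < 1 + m2%:R :> R by rewrite addr_gt0// (lt_trans _ m2_gt1).
(* The least level at which the diameter bound of [cover_squares] is at most [eps]; by minimality
   m1^j exceeds (1 + m2) / eps by a factor of at most m1. *)
have [j h1 h2] := bracket_power ((1 + m2%:R) / eps) m1_ge2.
have [N [U [XU Ud NC]]] := cover_squares (R := R) m1_ge2 m1_le_m2 C0 lam_gt0 gr j.
exists N, U; split => // [i|].
  apply: le_trans (Ud i) _; rewrite lee_fin ler_pdivrMr ?exprn_gt0//.
  by rewrite mulrC -ler_pdivrMr.
apply: le_trans NC _; rewrite -mulrA ler_pM2l//.
have [h _] := rate_bounds j m1_ge2 m1_le_m2 q_ge1 lam_ge1.
apply: le_trans h _.
rewrite -inv_powR; last exact: ltW.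
rewrite -powRM; [|by rewrite mulr_ge0 ?ltW|by rewrite invr_ge0 ltW].
 apply: ge0_ler_powR => //.
- exact: exponent_ge0.
- by rewrite nnegrE exprn_ge0// ltW.
- by rewrite nnegrE !mulr_ge0 ?invr_ge0 ?ltW.
(* At level 0 minimality says nothing, and [eps < 1] is used instead. *)
case: j h1 h2 {Ud} => [h1 _|j _ h2].
  rewrite expr0 -mulrA; apply: mulr_ege1; first exact: ltW.
  by rewrite ler_pdivlMr// mul1r (le_trans (ltW e1))// lerDl ltW// (lt_trans _ m2_gt1).
by rewrite exprS -mulrA ler_pM2l//; apply: ltW; exact: h2.
Qed.

Lemma sofic_dimensions_eq : has_minkowski_dim (sofic_set R G) /\
  hausdorff_dim (sofic_set R G) = minkowski_dim (sofic_set R G).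
Proof.
apply: dimensions_eq exponent_ge0 sofic_mass_bound sofic_covering.
  rewrite invr_gt0 !mulr_gt0 ?powR_gt0 ?exprn_gt0 ?ltr0n//.
    exact: leq_ltn_trans (ltn_ord i0).
  exact: ltnW.
by rewrite mulr_gt0// powR_gt0// mulr_gt0// addr_gt0// (lt_trans _ m2_gt1).
Qed.

End dimension.

Theorem corollary2p9 (R : realType) (m1 m2 n : nat)
    (G : labelled_graph n m1 m2) :
  (2 <= m1)%N -> (m1 <= m2)%N ->
  (0 < n)%N ->
  right_resolving G ->
  primitive_mx (adjacency_mx G R) ->
  uniform_complexity G R ->
  has_minkowski_dim (sofic_set R G) /\
  hausdorff_dim (sofic_set R G) = minkowski_dim (sofic_set R G).
Proof.
move=> m12 mm n0 rr prim [lam lam0 eig].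
have /choice[out source_out] i := primitive_out i prim.
pose i0 : 'I_n := Ordinal n0; pose s0 := (label (out i0)).1.
have s0l : s0 \in letters G by exact: letters_mem.
(* The eigenvector equations hold for letters that begin a sequence of the system; every edge does
   begin an infinite path, obtained by following [out]. *)
have lettersP s : s \in letters G -> sofic_proj1_letters G s.
  move=> /imsetP[e _ ->].
  have ip : infinite_path (extend out [:: e] (source e)).
    by apply: infinite_extend => //=; rewrite eqxx.
  exists (fun k => (label (extend out [:: e] (source e) k)).1) => //.
  exists (fun k => label (extend out [:: e] (source e) k)) => //.
  by exists (extend out [:: e] (source e)).
suff [lam_ge1 [C C0 gr]] : 1 <= lam /\ exists2 C : R, 0 < C & growth G C lam.
  exact: sofic_dimensions_eq source_out m12 mm rr C0 lam_ge1 gr.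
case: eig => -[v v0 vA].
  have H s : s \in letters G -> forall i,
      \sum_(e : edge G | (target e == i) && ((label e).1 == s)) v ord0 (source e)
      = lam * v ord0 i.
    move=> /lettersP/vA/matrixP/(_ ord0) E i; move: (E i); rewrite !mxE => <-.
    (* Grouping the edges by their source turns the edge sum into an entry of the row vector
       product. *)
    rewrite (sum_target_card _ _ (fun i => v ord0 i)); apply: eq_bigr => j _.
    rewrite mxE mulrC; congr (_ * _%:R); apply: eq_card => e; rewrite !inE.
    by rewrite andbC.
  split; last exact: growth_row i0 _ s0l lam0 v0 H.
  exact: eigenvalue_ge1 i0 lam0 v0 (H s0 s0l).
have H s : s \in letters G -> forall i,
    \sum_(e : edge G | (source e == i) && ((label e).1 == s)) v (target e) ord0
    = lam * v i ord0.
  move=> /lettersP/vA/matrixP E i; move: (E i ord0); rewrite !mxE => <-.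
  rewrite (sum_target_card _ _ (fun i => v i ord0)); apply: eq_bigr => j _.
  rewrite mxE; congr (_%:R * _); apply: eq_card => e; rewrite !inE.
  by rewrite andbAC andbA.
split; last exact: (growth_column (v := fun i => v i ord0) i0 s0l lam0 v0 H).
exact: (eigenvalue_ge1 (v := fun i => v i ord0) i0 lam0 v0 (H s0 s0l)).
Qed.
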